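(* Let $k$ be a field and let $Q$ be a quiver of type $\mathbb A_\infty^\infty$ or $\mathbb A_\infty$. If $M$ is an indecomposable object in $\mathrm{rep}(Q)$, then $M$ is finitely presented if and only if $M\cong M(w)$ with $w$ a string having no left infinite path.
   Context: $Q$ is of type $\mathbb A_\infty$ (respectively $\mathbb A_\infty^\infty$) if its underlying graph is $\circ-\circ-\circ-\cdots$ (respectively $\cdots-\circ-\circ-\circ-\cdots$), with arbitrary orientation. $\mathrm{rep}(Q)$ is the category of locally finite dimensional $k$-representations of $Q$ (each $M(x)$ finite dimensional). For a vertex $a$, $P_a$ is the representation with $P_a(x)$ the $k$-space with basis the set of paths from $a$ to $x$ (including the trivial path if $x=a$), an arrow $\alpha$ acting by $\rho\mapsto\alpha\rho$. $M$ is finitely presented if there is an exact sequence $0\to P_1\to P_0\to M\to0$ with $P_0,P_1$ finite direct sums of representations $P_a$. An edge of $Q$ is an arrow $\alpha$ or a formal inverse $\alpha^{-1}$ of an arrow (with starting and ending points interchanged). A walk is either trivial (one for each vertex) or a finite, right infinite, left infinite or double infinite product $\cdots c_{i+1}c_i\cdots$ of edges such that the ending point of $c_i$ is the starting point of $c_{i+1}$; it is reduced if $c_{i+1}\ne c_i^{-1}$ for all $i$. For a reduced walk $w$, $Q(w)$ is the full subquiver of $Q$ generated by the vertices appearing in $w$; $w$ is a string if $Q(w)$ contains at least one and at most finitely many sink or source vertices. $w$ has no left infinite path if $Q(w)$ contains no left infinite path $\cdots\to a_2\to a_1\to a_0$. The string representation $M(w)$ is defined by $M(w)(x)=k$ if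 the vertex $x$ appears in $w$ and $M(w)(x)=0$ otherwise; $M(w)(\alpha)=\mathrm{id}$ if $\alpha$ or $\alpha^{-1}$ appears in $w$, and $M(w)(\alpha)=0$ otherwise. *)

(* Defs.v *)
From HB Require Import structures.
From mathcomp Require Import all_boot all_order all_algebra.
From mathcomp Require Import boolp.
From mathcomp Require Import freeg.

Set Implicit Arguments.
Unset Strict Implicit.
Unset Printing Implicit Defensive.

Import GRing.Theory.
Local Open Scope ring_scope.

Record quiver := Quiver {
  vert : choiceType;
  arr : choiceType;
  src : arr -> vert;
  tgt : arr -> vert }.

Section Quivers.
Variable Q : quiver.
Implicit Types (a x y : vert Q) (al : arr Q).

Definition joins al x y : Prop :=
  (src al = x /\ tgt al = y) \/ (src al = y /\ tgt al = x).

Definition type_Ainf : Prop :=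
  exists (v : nat -> vert Q) (e : nat -> arr Q),
    [/\ bijective v, bijective e
      & forall n : nat, joins (e n) (v n) (v n.+1)].

Definition type_Ainfinf : Prop :=
  exists (v : int -> vert Q) (e : int -> arr Q),
    [/\ bijective v, bijective e
      & forall n : int, joins (e n) (v n) (v (n + 1))].

(* The arrows of a path are listed in the order in which they are travelled;
   the empty list is the trivial path. *)
Fixpoint is_path a (p : seq (arr Q)) x : bool :=
  if p is al :: p' then (src al == a) && is_path (tgt al) p' x else a == x.

Definition qpath a x := {p : seq (arr Q) | is_path a p x}.
HB.instance Definition _ a x := Choice.on (qpath a x).

Lemma is_path_rcons a al p :
  is_path a p (src al) -> is_path a (rcons p al) (tgt al).
Proof.
elim: p a => [|be p IHp] a /=; first by move/eqP->; rewrite !eqxx.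
by case/andP=> -> /IHp.
Qed.

Definition qpath_rcons a al (p : qpath a (src al)) : qpath a (tgt al) :=
  exist (fun p : seq (arr Q) => is_path a p (tgt al))
    (rcons (val p) al) (is_path_rcons (valP p)).

(* [inl al] is the edge al, [inr al] its formal inverse. *)
Definition edge : Type := (arr Q + arr Q)%type.

Definition edge_arr (c : edge) : arr Q :=
  match c with inl al => al | inr al => al end.
Definition edge_inv (c : edge) : edge :=
  match c with inl al => inr al | inr al => inl al end.
Definition edge_start (c : edge) : vert Q :=
  match c with inl al => src al | inr al => tgt al end.
Definition edge_end (c : edge) : vert Q :=
  match c with inl al => tgt al | inr al => src al end.

(* Products are written from right to left: [WFin c1 [:: c2; ...; cn]] is
   cn ... c2 c1, [WLeft c] is ... c(1) c(0), [WRight c] is c(0) c(1) ... and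
   [WDouble c] is ... c(1) c(0) c(-1) ... *)
Inductive edge_product : Type :=
| WTriv of vert Q
| WFin of edge & seq edge
| WLeft of nat -> edge
| WRight of nat -> edge
| WDouble of int -> edge.

Definition edge_in (w : edge_product) (c : edge) : Prop :=
  match w with
  | WTriv _ => False
  | WFin c1 s => exists2 i : nat, (i < (size s).+1)%N & c = nth c1 (c1 :: s) i
  | WLeft f => exists i, c = f i
  | WRight f => exists i, c = f i
  | WDouble f => exists i, c = f i
  end.

(* [consecutive w c d]: the product [w] has the form ... d c ... *)
Definition consecutive (w : edge_product) (c d : edge) : Prop :=
  match w with
  | WTriv _ => False
  | WFin c1 s => exists2 i : nat, (i < size s)%N
      & c = nth c1 (c1 :: s) i /\ d = nth c1 (c1 :: s) i.+1
  | WLeft f => exists i, c = f i /\ d = f i.+1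
  | WRight f => exists i, c = f i.+1 /\ d = f i
  | WDouble f => exists i, c = f i /\ d = f (i + 1)
  end.

Definition is_walk (w : edge_product) : Prop :=
  forall c d, consecutive w c d -> edge_end c = edge_start d.

Definition is_reduced (w : edge_product) : Prop :=
  forall c d, consecutive w c d -> d <> edge_inv c.

Definition vert_in (w : edge_product) x : Prop :=
  if w is WTriv y then x = y
  else exists2 c, edge_in w c & x = edge_start c \/ x = edge_end c.

Definition arr_in (w : edge_product) al : Prop :=
  edge_in w (inl al) \/ edge_in w (inr al).

(* The full subquiver Q(w): its vertices are those satisfying [vert_in w],
   its arrows those satisfying [full_arr w]. *)
Definition full_arr (w : edge_product) al : Prop :=
  vert_in w (src al) /\ vert_in w (tgt al).

Definition is_sink (w : edge_product) x : Prop :=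
  vert_in w x /\ forall al, full_arr w al -> src al <> x.

Definition is_source (w : edge_product) x : Prop :=
  vert_in w x /\ forall al, full_arr w al -> tgt al <> x.

Definition is_string (w : edge_product) : Prop :=
  [/\ is_walk w, is_reduced w,
      exists x, is_sink w x \/ is_source w x
    & exists s : seq (vert Q),
        forall x, is_sink w x \/ is_source w x -> x \in s].

Definition has_left_infinite_path (w : edge_product) : Prop :=
  exists p : nat -> arr Q,
    forall i, full_arr w (p i) /\ tgt (p i.+1) = src (p i).

End Quivers.

Record rep (k : fieldType) (Q : quiver) := Rep {
  rep_space :> vert Q -> lmodType k;
  rep_map : forall al : arr Q, {linear rep_space (src al) -> rep_space (tgt al)} }.

Section Representations.
Variables (k : fieldType) (Q : quiver).
Implicit Types M N L : rep k Q.

Definition locally_finite_dim M : Prop :=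
  forall x, exists (n : nat) (f : {linear M x -> 'rV[k]_n}), bijective f.

Record rep_hom M N := RepHom {
  hom_map :> forall x, {linear M x -> N x};
  hom_comm : forall (al : arr Q) (u : M (src al)),
    hom_map (tgt al) (rep_map M al u) = rep_map N al (hom_map (src al) u) }.

Definition rep_iso M N : Prop :=
  exists (f : rep_hom M N) (g : rep_hom N M),
    forall x, cancel (f x) (g x) /\ cancel (g x) (f x).

Definition is_zero_rep M : Prop := forall x (u : M x), u = 0.

Definition zero_rep : rep k Q :=
  @Rep k Q (fun=> 'rV[k]_0 : lmodType k)
    (fun=> GRing.null_fun 'rV[k]_0 : {linear 'rV[k]_0 -> 'rV[k]_0}).

Section DirectSum.
Variables M N : rep k Q.

Definition dsum_map (al : arr Q) (u : M (src al) * N (src al)) :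
  M (tgt al) * N (tgt al) := (rep_map M al u.1, rep_map N al u.2).

Lemma dsum_map_linear al : linear (@dsum_map al).
Proof. by move=> c u v; rewrite /dsum_map /= !linearP. Qed.

HB.instance Definition _ al :=
  GRing.isLinear.Build k (M (src al) * N (src al))%type
    (M (tgt al) * N (tgt al))%type _ (@dsum_map al) (@dsum_map_linear al).

Definition dsum_rep : rep k Q :=
  @Rep k Q (fun x => (M x * N x)%type : lmodType k)
    (fun al => @dsum_map al).

End DirectSum.

(* Indecomposability in the category of locally finite dimensional
   representations. *)
Definition indecomposable M : Prop :=
  ~ is_zero_rep M /\
  forall N L, locally_finite_dim N -> locally_finite_dim L ->
    rep_iso M (dsum_rep N L) -> is_zero_rep N \/ is_zero_rep L.

Section Projective.
Variable a : vert Q.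

Definition proj_map (al : arr Q) (u : {freeg (qpath a (src al)) / k}) :
    {freeg (qpath a (tgt al)) / k} :=
  fglift (fun p : qpath a (src al) => << qpath_rcons p >>) u.

Lemma proj_map_linear al : linear (@proj_map al).
Proof.
have add : additive (@proj_map al) by exact: lift_is_additive.
pose F : {additive _ -> _} := HB.pack (@proj_map al)
  (GRing.isAdditive.Build _ _ (@proj_map al) add).
have FE : @proj_map al = F by [].
move=> c u v; rewrite FE raddfD; congr (_ + _).
rewrite -[in RHS](freeg_sumE u) [c *: u]/(fgscale c u) /fgscale !raddf_sum.
apply: eq_bigr => p _.
by rewrite /= /proj_map !liftU scalerA.
Qed.

HB.instance Definition _ al :=
  GRing.isLinear.Build k {freeg (qpath a (src al)) / k}
    {freeg (qpath a (tgt al)) / k} _ (@proj_map al) (@proj_map_linear al).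

Definition proj_rep : rep k Q :=
  @Rep k Q (fun x => {freeg (qpath a x) / k} : lmodType k)
    (fun al => @proj_map al).

End Projective.

Definition proj_sum (s : seq (vert Q)) : rep k Q :=
  foldr (fun a N => dsum_rep (proj_rep a) N) zero_rep s.

Definition short_exact M N L (f : rep_hom M N) (g : rep_hom N L) : Prop :=
  forall x, [/\ injective (f x),
                forall v : N x, g x v = 0 <-> exists u : M x, f x u = v
              & forall t : L x, exists v : N x, g x v = t].

Definition finitely_presented M : Prop :=
  exists (s1 s0 : seq (vert Q)) (f : rep_hom (proj_sum s1) (proj_sum s0))
    (g : rep_hom (proj_sum s0) M), short_exact f g.

Section StringRep.
Variable w : edge_product Q.

Definition line (b : bool) : lmodType k :=
  if b then (k^o : lmodType k) else ('rV[k]_0 : lmodType k).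

(* The identity of k when both spaces are k, and zero otherwise. *)
Definition line_id (b c : bool) : {linear line b -> line c} :=
  match b, c return {linear line b -> line c} with
  | true, true => (idfun : {linear k^o -> k^o})
  | b, c => (GRing.null_fun (line c) : {linear line b -> line c})
  end.

Definition string_space (x : vert Q) : lmodType k := line `[< vert_in w x >].

Definition string_map (al : arr Q) :
    {linear string_space (src al) -> string_space (tgt al)} :=
  if `[< arr_in w al >] then line_id _ _
  else (GRing.null_fun (string_space (tgt al)) :
          {linear string_space (src al) -> string_space (tgt al)}).

Definition string_rep : rep k Q := Rep string_map.

End StringRep.

End Representations.

Arguments string_rep k {Q} w.

(* Main.v *)
Require Import Defs.
From HB Require Import structures.
From mathcomp Require Import all_boot all_order all_algebra.
From mathcomp Require Import boolp.
From mathcomp Require Import freeg.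
From mathcomp Require Import zify.

(* Place the vertices on an interval of the integers, arrows joining
   neighbours.

   If [M] is finitely presented, then far away on either side either [M]
   vanishes or all arrows point outwards and act bijectively.  Going inwards
   from there one constructs, at each vertex [x], a finite filtration [F] of
   [M x] such that a vector [v] of [F i.+1] and a linear form vanishing on
   [F i] with value 1 at [v] extend, on that side of [x], to homomorphisms from
   and to one and the same thin representation of an interval ending at [x].
   Choosing [v] in the first nonzero intersection of a term of the left and a
   term of the right filtration splits off from [M] the thin representation of
   an interval, so that an indecomposable [M] is thin.  An interval is the set
   of vertices of a walk, and the behaviour of [M] far away is precisely the
   string condition together with the absence of left infinite paths.

   Conversely, these conditions say that each end of the interval is either
   bounded or covered by a cone [P_b].  The thin representation of the interval
   is thus an iterated extension of cones and simple representations, and the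
   horseshoe lemma applies. *)

Set Implicit Arguments.
Unset Strict Implicit.
Unset Printing Implicit Defensive.

Import Order.TTheory GRing.Theory Num.Theory.
Local Open Scope ring_scope.

(** * Homomorphisms and direct sums of representations *)

Section RepHoms.
Variables (k : fieldType) (Q : quiver).
Implicit Types (M N L P : rep k Q) (a x y : vert Q) (al : arr Q).

Definition linear_of (U V : lmodType k) (f : U -> V) (Hf : linear f) :
  {linear U -> V} := HB.pack f (GRing.isLinear.Build k U V *:%R f Hf).

Definition hom_of M N (f : forall x, M x -> N x) (fL : forall x, linear (f x))
    (fC : forall al u, f (tgt al) (rep_map M al u) = rep_map N al (f _ u)) :
  rep_hom M N := @RepHom k Q M N (fun x => linear_of (fL x)) fC.

Definition hom_id M : rep_hom M M.
Proof. by apply: (@hom_of M M (fun x u => u)). Defined.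

Definition hom_comp M N L (g : rep_hom N L) (f : rep_hom M N) : rep_hom M L.
Proof.
apply: (@hom_of M L (fun x u => g x (f x u))) => [x c u v|al u].
  by rewrite !linearP.
by rewrite !hom_comm.
Defined.

Definition hom_zero M N : rep_hom M N.
Proof.
apply: (@hom_of M N (fun x u => 0)) => [x c u v|al u].
  by rewrite scaler0 addr0.
by rewrite linear0.
Defined.

Definition hom_opp M N (f : rep_hom M N) : rep_hom M N.
Proof.
apply: (@hom_of M N (fun x u => - f x u)) => [x c u v|al u].
  by rewrite linearP opprD scalerN.
by rewrite hom_comm linearN.
Defined.

Definition hom_copair M N L (f : rep_hom M L) (g : rep_hom N L) :
  rep_hom (dsum_rep M N) L.
Proof.
apply: (@hom_of (dsum_rep M N) L (fun x u => f x u.1 + g x u.2))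
  => [x c u v|al u].
  by rewrite !linearP /= scalerDr addrACA.
by rewrite /= !hom_comm linearD.
Defined.

Definition hom_pair M N L (f : rep_hom L M) (g : rep_hom L N) :
  rep_hom L (dsum_rep M N).
Proof.
apply: (@hom_of L (dsum_rep M N) (fun x u => (f x u, g x u))) => [x c u v|al u].
  by rewrite !linearP.
by rewrite !hom_comm.
Defined.

Definition hom_fst M N : rep_hom (dsum_rep M N) M.
Proof. by apply: (@hom_of (dsum_rep M N) M (fun x u => u.1)). Defined.

Definition hom_snd M N : rep_hom (dsum_rep M N) N.
Proof. by apply: (@hom_of (dsum_rep M N) N (fun x u => u.2)). Defined.

Lemma rep_iso_refl M : rep_iso M M.
Proof. by exists (hom_id M), (hom_id M). Qed.

Lemma rep_iso_sym M N : rep_iso M N -> rep_iso N M.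
Proof. by case=> f [g fg]; exists g, f => x; case: (fg x). Qed.

Lemma rep_iso_trans N M L : rep_iso M N -> rep_iso N L -> rep_iso M L.
Proof.
case=> f [g fg] [h [i hi]]; exists (hom_comp h f), (hom_comp g i) => x.
by have [fK gK] := fg x; have [hK iK] := hi x; split=> u /=; rewrite ?hK ?gK.
Qed.

Lemma dsum_iso M M' N N' : rep_iso M M' -> rep_iso N N' ->
  rep_iso (dsum_rep M N) (dsum_rep M' N').
Proof.
case=> f [f' fK] [g [g' gK]].
exists (hom_pair (hom_comp f (hom_fst M N)) (hom_comp g (hom_snd M N))).
exists (hom_pair (hom_comp f' (hom_fst M' N')) (hom_comp g' (hom_snd M' N'))).
move=> x; have [fK1 fK2] := fK x; have [gK1 gK2] := gK x.
by split=> -[u v] /=; rewrite ?fK1 ?fK2 ?gK1 ?gK2.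
Qed.

Lemma dsum_isoA M N L :
  rep_iso (dsum_rep (dsum_rep M N) L) (dsum_rep M (dsum_rep N L)).
Proof.
set D := dsum_rep (dsum_rep M N) L; set D' := dsum_rep M (dsum_rep N L).
exists (hom_pair (hom_comp (hom_fst _ _) (hom_fst _ _) : rep_hom D M)
  (hom_pair (hom_comp (hom_snd _ _) (hom_fst _ _)) (hom_snd _ _))).
exists (hom_pair
  (hom_pair (hom_fst _ _ : rep_hom D' _) (hom_comp (hom_fst _ _) (hom_snd _ _)))
  (hom_comp (hom_snd _ _) (hom_snd _ _))).
by move=> x; split=> [[[u v] w]|[u [v w]]].
Qed.

Lemma dsum_zero_iso M N : is_zero_rep M -> rep_iso (dsum_rep M N) N.
Proof.
move=> M0; exists (hom_snd M N), (hom_pair (hom_zero N M) (hom_id N)).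
by move=> x; split=> [[u v]|v] //=; rewrite [u]M0.
Qed.

Lemma dsum_zero_isor M N : is_zero_rep N -> rep_iso (dsum_rep M N) M.
Proof.
move=> N0; exists (hom_fst M N), (hom_pair (hom_id M) (hom_zero M N)).
by move=> x; split=> [[u v]|v] //=; rewrite [v]N0.
Qed.

Lemma is_zero_rep_iso M N : rep_iso M N -> is_zero_rep M -> is_zero_rep N.
Proof.
by case=> f [g fK] M0 x u; have [_ /(_ u) <-] := fK x;
  rewrite (M0 x (g x u)) linear0.
Qed.

Lemma indecomposable_iso M N :
  rep_iso M N -> indecomposable M -> indecomposable N.
Proof.
move=> MN [M0 Mind]; split=> [N0|N1 N2 N1f N2f N12].
  exact: M0 (is_zero_rep_iso (rep_iso_sym MN) N0).
exact: Mind N1f N2f (rep_iso_trans MN N12).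
Qed.

Lemma zero_rep_is_zero : is_zero_rep (zero_rep k Q).
Proof. by move=> x u; apply/rowP=> -[]. Qed.

End RepHoms.

(** * Projective and finitely presented representations *)

Section Projectives.
Variables (k : fieldType) (Q : quiver).
Implicit Types (M N L P : rep k Q) (a x y : vert Q) (al : arr Q).

(** Transport along an equality of vertices, and zero when they differ. It makes [path_act] total on
    lists of arrows: a list that is not a path from [a] to [x] acts as zero. *)
Definition castv M a x : {linear M a -> M x} :=
  if a =P x is ReflectT e then
    eq_rect a (fun y => {linear M a -> M y}) (idfun : {linear M a -> M a}) x e
  else (GRing.null_fun (M x) : {linear M a -> M x}).

Lemma castv_id M a u : castv M a a u = u.
Proof. by rewrite /castv; case: eqP => // e; rewrite (eq_axiomK e). Qed.

Fixpoint path_act M p a x : {linear M a -> M x} :=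
  if p is al :: p' then
    path_act M p' (tgt al) x \o rep_map M al \o castv M a (src al)
  else castv M a x.

Lemma path_act_rcons M p a al u : is_path a p (src al) ->
  path_act M (rcons p al) a (tgt al) u = rep_map M al (path_act M p a (src al)
    u).
Proof.
elim: p a u => [|be p IHp] a u /=.
  by move/eqP=> ea; subst a; rewrite !castv_id.
by case/andP=> _ /IHp ->.
Qed.

Definition trivial_path a : qpath a a :=
  exist (fun p => is_path a p a) [::] (eqxx a).

Lemma fglift_linear (K : choiceType) (V : lmodType k) (f : K -> V) :
  linear (fglift f : {freeg K / k} -> V).
Proof.
have add : zmod_morphism (fglift f : {freeg K / k} ->
  V) by exact: lift_is_additive.
pose F : {additive {freeg K / k} -> V} := HB.pack (fglift f)
  (GRing.isZmodMorphism.Build _ _ (fglift f) add).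
have FE : fglift f = F by [].
move=> c u v; rewrite FE raddfD; congr (_ + _).
rewrite -[in RHS](freeg_sumE u) [c *: u]/(fgscale c u) /fgscale !raddf_sum.
by apply: eq_bigr => p _; rewrite /= !liftU scalerA.
Qed.

Lemma linear_freegP (K : choiceType) (V : lmodType k)
    (f g : {linear {freeg K / k} -> V}) :
  (forall p, f << p >> = g << p >>) -> f =1 g.
Proof.
move=> fg u; rewrite -(freeg_sumE u) !linear_sum; apply: eq_bigr => p _.
have -> : << (coeff p u) *g p >> = coeff p u *: (<< p >> : {freeg K / k}).
  apply/eqP/freeg_eqP => q.
  by rewrite [_ *: _]/(fgscale _ _) coeff_fgscale !coeffU mul1r.
by rewrite !linearZ fg.
Qed.

Definition yoneda_fun M a (m : M a) x (u : proj_rep k a x) : M x :=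
  fglift (fun p : qpath a x => path_act M (val p) a x m) u.

Lemma yoneda_linear M a (m : M a) x : linear (@yoneda_fun M a m x).
Proof. exact: fglift_linear. Qed.

Lemma yoneda_comm M a (m : M a) al (u : proj_rep k a (src al)) :
  yoneda_fun m (rep_map (proj_rep k a) al u) = rep_map M al (yoneda_fun m u).
Proof.
pose F : {linear {freeg (qpath a (src al)) / k} -> M (tgt al)} :=
  linear_of (@yoneda_linear M a m (tgt al)) \o rep_map (proj_rep k a) al.
pose G : {linear {freeg (qpath a (src al)) / k} -> M (tgt al)} :=
  rep_map M al \o linear_of (@yoneda_linear M a m (src al)).
suff: F =1 G by apply.
apply: linear_freegP => p.
rewrite /F /G /= /yoneda_fun /= /proj_map !liftU !scale1r liftU scale1r /=.
by rewrite path_act_rcons ?(valP p).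
Qed.

Definition yoneda M a (m : M a) : rep_hom (proj_rep k a) M :=
  hom_of (@yoneda_linear M a m) (@yoneda_comm M a m).

Lemma yonedaE M a (m : M a) x (p : qpath a x) :
  yoneda m x << p >> = path_act M (val p) a x m.
Proof. by rewrite /= /yoneda_fun liftU scale1r. Qed.

Lemma is_path_rconsE a q al y :
  is_path a (rcons q al) y -> is_path a q (src al) /\ tgt al = y.
Proof.
elim: q a => [|be q IHq] a /=; first by case/andP=> /eqP -> /eqP ->.
by case/andP=> -> /IHq.
Qed.

Lemma freeg_val_inj a x (p q : qpath a x) :
  val p = val q -> << p >> = << q >> :> {freeg (qpath a x) / k}.
Proof. by move=> /val_inj ->. Qed.

(** [P_a] is generated by its trivial path: appending an arrow to a path is the action of that
    arrow, so induction on the last arrow applies. This yields uniqueness in the Yoneda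
    correspondence. *)
Lemma qpath_act a x (p : qpath a x) :
  path_act (proj_rep k a) (val p) a x << trivial_path a >> = << p >>.
Proof.
have gen : forall (q : seq (arr Q)) y (pq : is_path a q y),
    path_act (proj_rep k a) q a y << trivial_path a >> =
    << (exist _ q pq : qpath a y) >>.
  elim/last_ind=> [|q al IHq] y pq.
    have ea : a = y by apply/eqP.
    subst y; rewrite castv_id.
    by apply: freeg_val_inj.
  have [pq' ey] := is_path_rconsE pq.
  subst y; rewrite path_act_rcons // (IHq _ pq') /= /proj_map liftU scale1r.
  by apply: freeg_val_inj.
by rewrite (gen _ _ (valP p)); apply: freeg_val_inj.
Qed.

Lemma hom_path_act M N (h : rep_hom M N) p a x u : is_path a p x ->
  h x (path_act M p a x u) = path_act N p a x (h a u).
Proof.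
elim: p a u => [|al p IHp] a u /=; first by move/eqP=> e; subst a;
  rewrite !castv_id.
by case/andP=> /eqP e /IHp; subst a; rewrite !castv_id => ->; rewrite hom_comm.
Qed.

Lemma proj_hom_ext M a (h h' : rep_hom (proj_rep k a) M) :
  h a << trivial_path a >> = h' a << trivial_path a >> ->
  forall x u, h x u = h' x u.
Proof.
move=> hh x; apply: linear_freegP => p.
by rewrite -qpath_act !hom_path_act ?(valP p) // hh.
Qed.

(** Up to isomorphism, the terms allowed in a presentation; finite generation is built in, and the
    lifting property is derived. *)
Definition projective P : Prop := exists s, rep_iso P (proj_sum k s).

Lemma projective_iso P P' : rep_iso P P' -> projective P -> projective P'.
Proof. by move=> /rep_iso_sym i [s j]; exists s; apply: rep_iso_trans j. Qed.

Lemma projective_proj a : projective (proj_rep k a).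
Proof.
exists [:: a]; exists (hom_pair (hom_id _) (hom_zero _ _)), (hom_fst _ _).
by move=> x; split=> [u|[u v]] //=; rewrite [v](@zero_rep_is_zero k Q x).
Qed.

Lemma projective_zero P : is_zero_rep P -> projective P.
Proof.
move=> P0; exists [::], (hom_zero _ _), (hom_zero _ _) => x.
by split=> u; rewrite /= 1?[u]P0 1?[u](@zero_rep_is_zero k Q x).
Qed.

Lemma projective_dsum P P' :
  projective P -> projective P' -> projective (dsum_rep P P').
Proof.
move=> [s i] [s' i']; exists (s ++ s').
apply: rep_iso_trans (dsum_iso i i') _ => {i i'}.
elim: s => [|a s IHs] /=; first by apply/dsum_zero_iso/zero_rep_is_zero.
apply: rep_iso_trans (dsum_isoA _ _ _) _.
exact: dsum_iso (rep_iso_refl _) IHs.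
Qed.

(* [g] need not be surjective: it is enough that its image contains that of
   [h]. *)
Lemma projective_lift P N L (g : rep_hom N L) (h : rep_hom P L) :
  projective P -> (forall x u, exists v, g x v = h x u) ->
  exists h' : rep_hom P N, forall x u, g x (h' x u) = h x u.
Proof.
move=> [s [i [j ij]]] gh.
suff [h' h'E] : exists h' : rep_hom (proj_sum k s) N,
    forall x u, g x (h' x u) = hom_comp h j x u.
  exists (hom_comp h' i) => x u; rewrite /= h'E /=.
  by have [-> _] := ij x.
have {gh} : forall x u, exists v, g x v = hom_comp h j x u.
  by move=> x u; apply: gh.
move: (hom_comp h j) => {i j ij} {}h; elim: s h => [|a s IHs] /= h gh.
  by exists (hom_zero _ _) => x u;
    rewrite [u](@zero_rep_is_zero k Q x) !linear0.
pose h1 := hom_comp h (hom_pair (hom_id (proj_rep k a)) (hom_zero _ _)).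
pose h2 := hom_comp h (hom_pair (hom_zero _ _) (hom_id (proj_sum k s))).
(* By the Yoneda correspondence, lifting on the summand [P_a] amounts to lifting the image of its
   trivial path. *)
have [v vE] := gh a (<< trivial_path a >>, 0).
have [|h' h'E] := IHs h2; first by move=> x u; apply: gh.
exists (hom_copair (yoneda v) h') => x [u w].
transitivity (h1 x u + h2 x w).
  rewrite /= linearD h'E; congr (_ + _).
  apply: (@proj_hom_ext _ _ (hom_comp g (yoneda v)) h1).
  by rewrite /= -vE; congr (g a _); rewrite -[RHS]castv_id; apply: yonedaE.
by rewrite /= -linearD /=; congr (h x (_, _)); rewrite ?addr0 ?add0r.
Qed.

Lemma finitely_presented_iso M N :
  rep_iso M N -> finitely_presented M -> finitely_presented N.
Proof.
case=> i [j ij] [s1 [s0 [f [g fg]]]].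
exists s1, s0, f, (hom_comp i g) => x; have [finj ker surj] := fg x.
have [iK jK] := ij x.
split=> // [v|t].
  rewrite -ker /=; split=> [e|->]; last by rewrite linear0.
  by rewrite -[g x v]iK e linear0.
by have [v vE] := surj (j x t); exists v; rewrite /= vE jK.
Qed.

Lemma projective_presentation M P1 P0 (f : rep_hom P1 P0) (g : rep_hom P0 M) :
  projective P1 -> projective P0 -> short_exact f g -> finitely_presented M.
Proof.
move=> [s1 [i1 [j1 ij1]]] [s0 [i0 [j0 ij0]]] fg.
exists s1, s0, (hom_comp i0 (hom_comp f j1)), (hom_comp g j0) => x.
have [i1K j1K] := ij1 x; have [i0K j0K] := ij0 x; have [finj ker surj] := fg x.
split.
- move=> u v /(can_inj i0K)/finj; exact: (can_inj j1K).
- move=> v /=; rewrite ker; split=> [] [u uE].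
    by exists (i1 x u); rewrite i1K uE j0K.
  by exists (j1 x u); rewrite -uE i0K.
- by move=> t; have [v vE] := surj t; exists (i0 x v); rewrite /= i0K.
Qed.

Lemma projective_sum s : projective (proj_sum k s).
Proof. by exists s; apply: rep_iso_refl. Qed.

Lemma projective_finitely_presented P : projective P -> finitely_presented P.
Proof.
move=> [s i]; apply: (finitely_presented_iso (rep_iso_sym i)).
exists [::], s, (hom_zero _ _), (hom_id _) => x; split=> [u v _|v|t].
- by rewrite [u](@zero_rep_is_zero k Q x) [v](@zero_rep_is_zero k Q x).
- by split=> [/= ->|[u <-]] //; exists 0.
- by exists t.
Qed.

(** The horseshoe lemma: [g2] is lifted through [p] to [g0], and a map [h] corrects the relations of
    the quotient by elements coming from [M']. *)
Lemma finitely_presented_ext M' M M'' (i : rep_hom M' M) (p : rep_hom M M'') :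
  short_exact i p -> finitely_presented M' -> finitely_presented M'' ->
  finitely_presented M.
Proof.
move=> ip [s1 [s0 [f1 [g1 fg1]]]] [t1 [t0 [f2 [g2 fg2]]]].
have [|g0 g0E] := @projective_lift _ _ _ p g2 (projective_sum t0).
  by move=> x u; have [_ _ /(_ (g2 x u))] := ip x.
(* [p] kills [g0 f2], so this composite lands in the image of [i] and lifts along [i g1]; the minus
   sign makes [G] vanish on the image of [F]. *)
have [|h hE] := @projective_lift _ _ _ (hom_comp i g1)
    (hom_opp (hom_comp g0 f2)) (projective_sum t1).
  move=> x u; have [_ keri _] := ip x; have [_ _ g1surj] := fg1 x.
  have [_ ker2 _] := fg2 x.
  have /keri[u' u'E] : p x (- g0 x (f2 x u)) = 0.
    by rewrite linearN g0E (proj2 (ker2 _)) ?oppr0 //; exists u.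
  by have [u'' u''E] := g1surj u'; exists u''; rewrite /= u''E.
pose F := hom_pair (hom_copair f1 h) (hom_comp f2 (hom_snd (proj_sum k s1) _)).
pose G := hom_copair (hom_comp i g1) g0.
apply: (@projective_presentation M _ _ F G);
  try by apply: projective_dsum; apply: projective_sum.
move=> x; have [finj1 ker1 surj1] := fg1 x; have [finj2 ker2 surj2] := fg2 x.
have [iinj keri surjp] := ip x; split.
- apply: raddf_inj => -[u w] /= [e1 e2].
  have w0 : w = 0 by apply: finj2; rewrite e2 linear0.
  move: e1; rewrite w0 linear0 addr0 => e1.
  by congr (_, _); apply: finj1; rewrite e1 linear0.
- move=> [u v] /=; split=> [e|[[u' w]]] /=; last first.
    case=> <- <-; rewrite !linearD /=; have := hE x w => /= ->.
    by rewrite (proj2 (ker1 _)) ?linear0 ?add0r ?addNr //; exists u'.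
  have /ker2[w wE] : g2 x v = 0.
    have pi0 : p x (i x (g1 x u)) = 0 by apply/keri; exists (g1 x u).
    by have := congr1 (p x) e; rewrite linearD linear0 pi0 add0r g0E.
  have /ker1[u' u'E] : g1 x (u - h x w) = 0.
    apply: iinj; rewrite linear0 !linearB /=; have := hE x w => /= ->.
    by rewrite opprK wE.
  by exists (u', w); rewrite /= u'E wE subrK.
- move=> t; have [v vE] := surj2 (p x t).
  have /keri[m mE] : p x (t - g0 x v) = 0 by rewrite linearB g0E vE subrr.
  have [u uE] := surj1 m.
  by exists (u, v); rewrite /= uE mE subrK.
Qed.

End Projectives.

(** * Thin representations *)

Section Thin.
Variables (k : fieldType) (Q : quiver).
Implicit Types (M N L P : rep k Q) (a x y : vert Q) (al : arr Q).
Implicit Types (A B : pred (vert Q)).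

Definition thin A : rep k Q :=
  @Rep k Q (fun x => line k (A x)) (fun al => line_id k (A (src al)) (A (tgt
    al))).

(** [thin_one] and [thin_coef] are a generator and the coordinate along it, both zero outside [A];
    they spare case distinctions on the dependent type [line]. *)
Definition thin_one A x : thin A x := line_id k true (A x) (1 : k^o).

Definition thin_coef A x (u : thin A x) : k^o := line_id k (A x) true u.

Lemma thin_coefK A x (u : thin A x) : thin_coef u *: thin_one A x = u.
Proof.
rewrite /thin_coef /thin_one; move: u; rewrite /=; case: (A x) => /= u.
  by rewrite [_ *: _]mulr1.
by apply/rowP=> -[].
Qed.

Lemma thin_coefZ A x c (u : thin A x) : thin_coef (c *: u) = c * thin_coef u.
Proof. by rewrite /thin_coef linearZ. Qed.

Lemma thin_coef_one A x : A x -> thin_coef (thin_one A x) = 1.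
Proof. by rewrite /thin_coef /thin_one => ->. Qed.

Lemma thin_eq0 A x (u : thin A x) : ~~ A x -> u = 0.
Proof. by move: u; rewrite /=; case: (A x) => //= u _; apply/rowP=> -[]. Qed.

Lemma thin_map A al (u : thin A (src al)) : A (src al) -> A (tgt al) ->
  rep_map (thin A) al u = thin_coef u *: thin_one A (tgt al).
Proof.
rewrite /thin_coef /thin_one /=; move: u; rewrite /=.
by case: (A (src al)); case: (A (tgt al)) => //= u _ _; rewrite [_ *: _]mulr1.
Qed.

Lemma thin_locally_finite_dim A : locally_finite_dim (thin A).
Proof.
move=> x; rewrite /=; case: (A x) => /=; last first.
  by exists 0%N, idfun; exists idfun.
have rL : linear (fun c : k^o => c%:M : 'rV[k]_1).
  by move=> c u v; apply/rowP=> j; rewrite ord1 !mxE !eqxx !mulr1n.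
exists 1%N, (linear_of rL); exists (fun m : 'rV[k]_1 => m 0 0 : k^o) => u /=.
  by rewrite mxE eqxx.
by apply/rowP=> j; rewrite ord1 mxE eqxx.
Qed.

Lemma thin_neq0 A x : A x -> ~ is_zero_rep (thin A).
Proof.
move=> Ax /(_ x (thin_one A x)) A0; have := thin_coef_one Ax.
by rewrite A0 /thin_coef linear0 => /eqP; rewrite eq_sym oner_eq0.
Qed.

(** Both composites of the square are the identity of [k] or zero. They can differ only if [A]
    contains the source and [B] the target; then one is nonzero exactly if [A] contains the target,
    the other exactly if [B] contains the source. *)
Lemma thin_hom_proof A B
    (AB : forall al, A (src al) -> B (tgt al) -> A (tgt al) = B (src al)) :
  forall al (u : thin A (src al)),
  line_id k (A (tgt al)) (B (tgt al)) (rep_map (thin A) al u) =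
  rep_map (thin B) al (line_id k (A (src al)) (B (src al)) u).
Proof.
move=> al /=; move: (AB al).
case: (A (src al)); case: (A (tgt al)); case: (B (src al));
  case: (B (tgt al)) => //=.
all: by move=> /(_ isT isT).
Qed.

Definition thin_hom A B
    (AB : forall al, A (src al) -> B (tgt al) -> A (tgt al) = B (src al)) :
  rep_hom (thin A) (thin B) :=
  @RepHom k Q (thin A) (thin B) (fun x => line_id k (A x) (B x)) (thin_hom_proof
    AB).

Definition arrow_from A B := exists al, A (src al) /\ B (tgt al).

(** As no arrow leads from [A2] into [A1], the set [A2] carries a subrepresentation, and [A1] the
    quotient. *)
Lemma thin_exact A A1 A2 : (forall x, A x = A1 x || A2 x) ->
  (forall x, A1 x -> ~~ A2 x) -> ~ arrow_from A2 A1 ->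
  exists (i : rep_hom (thin A2) (thin A)) (p : rep_hom (thin A) (thin A1)),
    short_exact i p.
Proof.
move=> AE A12 A21.
have i_ok al : A2 (src al) -> A (tgt al) -> A2 (tgt al) = A (src al).
  move=> A2s; rewrite !AE A2s orbT => /orP[A1t|-> //].
  by case: A21; exists al.
have p_ok al : A (src al) -> A1 (tgt al) -> A (tgt al) = A1 (src al).
  rewrite !AE => /orP[A1s|A2s] A1t; first by rewrite A1t A1s.
  by case: A21; exists al.
exists (thin_hom i_ok), (thin_hom p_ok) => x.
have Ax := AE x; have A12x := A12 x; move: Ax A12x => /=.
case: (A1 x); case: (A2 x) => /= -> //= A12x; first by have := A12x isT.
- split=> [u v _|v|t]; last by exists t.
    by apply/rowP=> -[].
  by split=> [->|[u <-]] //; exists 0.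
- split=> [u v //|v|t]; last by exists 0; apply/rowP=> -[].
  by split=> // _; exists v.
- split=> [u v _|v|t]; try by exists 0; apply/rowP=> -[].
    by apply/rowP=> -[].
  by split=> // _; exists v; apply/rowP=> -[].
Qed.

Lemma thin_ext A A1 A2 : (forall x, A x = A1 x || A2 x) ->
  (forall x, A1 x -> ~~ A2 x) -> ~ arrow_from A2 A1 ->
  finitely_presented (thin A1) -> finitely_presented (thin A2) ->
  finitely_presented (thin A).
Proof.
move=> AE A12 A21 fp1 fp2; have [i [p ip]] := thin_exact AE A12 A21.
exact: finitely_presented_ext ip fp2 fp1.
Qed.

Lemma thin_dsum A A1 A2 : (forall x, A x = A1 x || A2 x) ->
  (forall x, A1 x -> ~~ A2 x) -> ~ arrow_from A2 A1 -> ~ arrow_from A1 A2 ->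
  rep_iso (dsum_rep (thin A1) (thin A2)) (thin A).
Proof.
move=> AE A12 A21 A21'.
have i2 al : A2 (src al) -> A (tgt al) -> A2 (tgt al) = A (src al).
  move=> A2s; rewrite !AE A2s orbT => /orP[A1t|-> //].
  by case: A21; exists al.
have i1 al : A1 (src al) -> A (tgt al) -> A1 (tgt al) = A (src al).
  move=> A1s; rewrite !AE A1s => /orP[-> //|A2t].
  by case: A21'; exists al.
have p1 al : A (src al) -> A1 (tgt al) -> A (tgt al) = A1 (src al).
  rewrite !AE => /orP[A1s|A2s] A1t; first by rewrite A1t A1s.
  by case: A21; exists al.
have p2 al : A (src al) -> A2 (tgt al) -> A (tgt al) = A2 (src al).
  rewrite !AE => /orP[A1s|->] A2t; last by rewrite A2t orbT.
  by case: A21'; exists al.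
exists (hom_copair (thin_hom i1) (thin_hom i2)).
exists (hom_pair (thin_hom p1) (thin_hom p2)) => x.
have Ax := AE x; have A12x := A12 x; move: Ax A12x => /=.
case: (A1 x); case: (A2 x) => /= -> //= A12x; first by have := A12x isT.
- split=> [[u v]|v] /=; rewrite ?addr0 //.
  by congr (_, _); apply/rowP=> -[].
- split=> [[u v]|v] /=; rewrite ?add0r //.
  by congr (_, _); apply/rowP=> -[].
- split=> [[u v]|v] /=; rewrite ?add0r //; last by apply/rowP=> -[].
  by congr (_, _); apply/rowP=> -[].
Qed.

Section HomFromThin.
Variables (A : pred (vert Q)) (M : rep k Q) (m : forall x, M x).
Hypothesis m0 : forall x, ~~ A x -> m x = 0.
Hypothesis mC : forall al, A (src al) -> rep_map M al (m (src al)) = m (tgt al).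

(** [mC] constrains only arrows starting in [A], the source space being zero otherwise. For an arrow
    leaving [A] it says, with [m0], that the vector is killed. *)
Definition hom_thin : rep_hom (thin A) M.
Proof.
apply: (@hom_of k Q (thin A) M (fun x u => thin_coef u *: m x)) => [x c u v|al
  u].
  by rewrite /thin_coef linearP scalerDl scalerA.
have /orP[As|As] := orbN (A (src al)); last first.
  by rewrite [u]thin_eq0 // linear0 /thin_coef !linear0 !scale0r linear0.
rewrite linearZ /= mC //; have /orP[At|At] := orbN (A (tgt al)); last first.
  by rewrite m0 // !scaler0.
by rewrite (thin_map u As At) thin_coefZ thin_coef_one // mulr1.
Defined.

Lemma hom_thinE x u : hom_thin x u = thin_coef u *: m x.
Proof. by []. Qed.

End HomFromThin.

(** * Cones of reachable vertices and the representations [P_a] *)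

Definition reach a x := `[< exists p, is_path a p x >].

Lemma reachP a x : reflect (exists p, is_path a p x) (reach a x).
Proof. exact: asboolP. Qed.

Lemma reach_refl a : reach a a.
Proof. by apply/reachP; exists [::] => /=. Qed.

Lemma reach_arr a al : reach a (src al) -> reach a (tgt al).
Proof. by move=> /reachP[p ap]; apply/reachP; exists (rcons p al);
  exact: is_path_rcons. Qed.

Definition unique_paths a :=
  forall x p q, is_path a p x -> is_path a q x -> p = q.

Section Generator.
Variables (a : vert Q) (M : rep k Q) (v : M a).
Hypothesis aU : unique_paths a.

Definition reach_path x : seq (arr Q) :=
  if pselect (exists p, is_path a p x) is left e then projT1 (cid e) else [::].

Lemma reach_pathP x : reach a x -> is_path a (reach_path x) x.
Proof.
move/reachP=> e; rewrite /reach_path; case: pselect => // e'.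
by case: (cid e').
Qed.

Definition generated x : M x :=
  if reach a x then path_act M (reach_path x) a x v else 0.

Lemma generated0 x : ~~ reach a x -> generated x = 0.
Proof. by rewrite /generated => /negPf ->. Qed.

Lemma generated_path p x : is_path a p x -> generated x = path_act M p a x v.
Proof.
move=> pP; have rx : reach a x by apply/reachP; exists p.
by rewrite /generated rx (aU (reach_pathP rx) pP).
Qed.

Lemma generated_id : generated a = v.
Proof. by rewrite (@generated_path [::]) /= ?castv_id. Qed.

Lemma generated_map al : reach a (src al) ->
  rep_map M al (generated (src al)) = generated (tgt al).
Proof.
move=> /reachP[p pP]; rewrite (generated_path pP) -path_act_rcons //.
by rewrite (generated_path (is_path_rcons pP)).
Qed.

Definition hom_reach : rep_hom (thin (reach a)) M :=
  hom_thin generated0 generated_map.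

End Generator.

Lemma hom_reach_one a M (v : M a) (aU : unique_paths a) :
  hom_reach v aU a (thin_one _ a) = v.
Proof. by rewrite hom_thinE thin_coef_one ?reach_refl // scale1r generated_id.
  Qed.

Lemma thin_path_act a p x : is_path a p x ->
  path_act (thin (reach a)) p a x (thin_one _ a) = thin_one _ x.
Proof.
elim/last_ind: p x => [|p al IHp] x.
  by move=> /= /eqP e; subst x; rewrite castv_id.
move=> /is_path_rconsE[pP ex]; subst x; rewrite path_act_rcons // IHp //.
have rs : reach a (src al) by apply/reachP; exists p.
by rewrite (thin_map _ rs (reach_arr rs)) thin_coef_one // scale1r.
Qed.

Lemma hom_linearZ M N (h : rep_hom M N) x c u : h x (c *: u) = c *: h x u.
Proof. exact: linearZ. Qed.

(** Uniqueness of paths makes [P_a(x)] at most one dimensional, and nonzero exactly on the cone of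
    [a]. The two maps match the generators at [a]; the composite on [P_a] is the identity because it
    fixes the trivial path. *)
Lemma thin_reach_iso a : unique_paths a ->
  rep_iso (thin (reach a)) (proj_rep k a).
Proof.
move=> aU; pose f := hom_reach (M := proj_rep k a) << trivial_path a >> aU.
pose g := yoneda (thin_one (reach a) a).
have gtriv : g a << trivial_path a >> = thin_one (reach a) a.
  by rewrite yonedaE /= castv_id.
exists f, g => x; split=> u.
  transitivity (thin_coef u *: g x (f x (thin_one _ x))).
    by rewrite -[X in g x (f x X)]thin_coefK (hom_linearZ f) (hom_linearZ g).
  rewrite -[RHS]thin_coefK; congr (_ *: _).
  case: (boolP (reach a x)) => [/reachP[p pP]|nr]; last first.
    by rewrite (thin_eq0 (thin_one (reach a) x) nr) !linear0.
  by rewrite -(thin_path_act pP) !hom_path_act // hom_reach_one gtriv.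
have := @proj_hom_ext k Q _ a (hom_comp f g) (hom_id _).
apply; transitivity (f a (g a << trivial_path a >>)) => //.
by rewrite gtriv hom_reach_one.
Qed.

Lemma projective_thin_reach a : unique_paths a -> projective (thin (reach a)).
Proof.
move=> /thin_reach_iso i; apply: projective_iso (rep_iso_sym i) _.
exact: projective_proj.
Qed.

Lemma projective_thin0 A : (forall x, ~~ A x) -> projective (thin A).
Proof. by move=> A0; apply: projective_zero => x u; apply: thin_eq0. Qed.

End Thin.

(** * Quivers on a line *)

Section Line.
Variable Q : quiver.
Implicit Types (a x y z : vert Q) (al be : arr Q) (A : pred (vert Q)).

(* A placement of the vertices on an interval of the integers such that the
   arrows are exactly the links between neighbours, one for each pair.
   Negating the positions gives another such placement, which is how the
   left-right symmetry is exploited. *)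
Record line_pos (pos : vert Q -> int) : Prop := LinePos {
  pos_inj : injective pos;
  pos_conv : forall x y m, pos x <= m -> m <= pos y -> exists z, pos z = m;
  pos_arr : forall al,
    pos (tgt al) = pos (src al) + 1 \/ pos (src al) = pos (tgt al) + 1;
  pos_edge : forall x y, pos y = pos x + 1 -> exists al, joins al x y;
  pos_uniq : forall al be, joins al (src be) (tgt be) -> al = be }.

Lemma line_pos_opp pos : line_pos pos -> line_pos (fun x => - pos x).
Proof.
case=> inj conv arrP edgeP uniqP; split=> //.
- by move=> x y /oppr_inj/inj.
- move=> x y m xm my; have [||z zm] := conv y x (- m); try lia.
  by exists z; lia.
- by move=> al; case: (arrP al) => h; [right|left]; lia.
- move=> x y e; have [|al alP] := edgeP y x; first by lia.
  by exists al; case: alP; [right|left].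
Qed.

(** Covers both types at once: the arrow [e i] occupies the gap between the positions [p i] and
    [p i + 1], so injectivity of [p] allows one arrow per gap. *)
Lemma line_pos_intro (I : Type) (e : I -> arr Q) (p : I -> int) pos :
  injective pos ->
  (forall x y m, pos x <= m -> m <= pos y -> exists z, pos z = m) ->
  (forall al, exists i, al = e i) -> injective p ->
  (forall i, exists x y, [/\ joins (e i) x y, pos x = p i & pos y = p i + 1]) ->
  (forall x y, pos y = pos x + 1 -> exists i, p i = pos x) ->
  line_pos pos.
Proof.
move=> inj conv eS pI eP pS; split=> //.
- move=> al; have [i ->] := eS al; have [x [y [xy xi yi]]] := eP i.
  by case: xy => [] [-> ->]; [left|right]; lia.
- move=> x y xy; have [i ip] := pS _ _ xy; exists (e i).
  have [x' [y' [j xi yi]]] := eP i.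
  have -> : x = x' by apply: inj; lia.
  by have -> : y = y' by apply: inj; lia.
- move=> al be; have [i ->] := eS al; have [j ->] := eS be.
  have [x [y [xy xi yi]]] := eP i; have [x' [y' [xy' xi' yi']]] := eP j.
  move=> J; congr e; apply: pI.
  (* The two gaps share both ends; a match with the ends exchanged would give [p i = p j + 1] and
     [p j = p i + 1]. *)
  suff [[ex _]|[ex ey]] : (x = x' /\ y = y') \/ (x = y' /\ y = x').
  - by rewrite -xi ex.
  - by move: ex ey => /(congr1 pos) + /(congr1 pos); lia.
  by case: xy => [] [e1 e2]; case: xy' => [] [e3 e4];
    case: J => [] [e5 e6]; try (by left; split; congruence);
    right; split; congruence.
Qed.

Lemma line_pos_exists : type_Ainfinf Q \/ type_Ainf Q -> exists pos,
  line_pos pos.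
Proof.
case=> [] [v [e [[v' vK v'K] [e' eK e'K] vP]]].
  exists v'; apply: (@line_pos_intro _ e id) => //.
  - exact: can_inj v'K.
  - by move=> x y m _ _; exists (v m); rewrite vK.
  - by move=> al; exists (e' al); rewrite e'K.
  - by move=> i; exists (v i), (v (i + 1)); rewrite !vK.
  - by move=> x y _; exists (v' x).
exists (fun x => (v' x)%:Z); apply: (@line_pos_intro _ e Posz).
- by move=> x y []; apply: (can_inj v'K).
- move=> x y m xm my; exists (v `|m|%N); rewrite vK; lia.
- by move=> al; exists (e' al); rewrite e'K.
- by move=> i j [].
- by move=> i; exists (v i), (v i.+1); rewrite !vK; split=> //; lia.
- by move=> x y _; exists (v' x).
Qed.

End Line.

Section LineTheory.
Variables (Q : quiver) (pos : vert Q -> int) (posP : line_pos pos).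
Implicit Types (a x y z : vert Q) (al be : arr Q) (A : pred (vert Q)).

Lemma parallel_eq al be : pos (src al) = pos (src be) ->
  pos (tgt al) = pos (tgt be) -> al = be.
Proof.
move=> /(pos_inj posP) es /(pos_inj posP) et.
by apply: (pos_uniq posP); left.
Qed.

(** Two such arrows join the same vertices, hence coincide, and the common arrow would be a loop;
    but the ends of an arrow have different positions. *)
Lemma antiparallelF al be : pos (src al) = pos (tgt be) ->
  pos (tgt al) = pos (src be) -> False.
Proof.
move=> es et; have e : al = be.
  by apply: (pos_uniq posP); right; split; apply: (pos_inj posP).
by move: es et (pos_arr posP be); rewrite e; lia.
Qed.

Lemma reach_cons a al y : src al = a -> reach (tgt al) y -> reach a y.
Proof.
by move=> e /reachP[p pP]; apply/reachP; exists (al :: p); rewrite /= e eqxx.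
Qed.

(** A discrete intermediate value property: each arrow moves by one, so a path from the left to the
    right of a gap travels an arrow across it. *)
Lemma reach_cross a x m : reach a x -> pos a <= m -> m < pos x ->
  exists be, [/\ pos (src be) = m, pos (tgt be) = m + 1 & reach a (src be)].
Proof.
move=> /reachP[p]; elim: p a => [|al p IHp] a /=.
  by move/eqP=> ->; lia.
case/andP=> /eqP ea pP am mx; have [tm|tm] := leP (pos (tgt al)) m.
  have [be [e1 e2 r]] := IHp _ pP tm mx.
  by exists be; split=> //; apply: reach_cons r.
exists al; rewrite ea; have := pos_arr posP al; rewrite ea => alP.
by split; [lia|lia|apply: reach_refl].
Qed.

End LineTheory.

Section LineCones.
Variables (Q : quiver) (pos : vert Q -> int) (posP : line_pos pos).
Implicit Types (a x y z : vert Q) (al be : arr Q) (A : pred (vert Q)).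

(** A path in a line never turns back, as it would cross some gap by two antiparallel arrows. So the
    paths from [src al] to vertices on its right are those beginning with [al]. *)
Lemma reach_cone al y : pos (tgt al) = pos (src al) + 1 ->
  reach (tgt al) y = reach (src al) y && (pos (src al) < pos y).
Proof.
move=> alP; apply/idP/andP=> [r|[/reachP[[|be p]]]] /=.
- split; first exact: reach_cons r.
  rewrite ltNge; apply/negP => le.
  have [||be [e1 e2 _]] := @reach_cross _ _ (line_pos_opp posP) _ _
    (- pos (tgt al)) r; try lia.
  by apply: (@antiparallelF _ _ posP al be); lia.
- by move/eqP=> ->; rewrite ltxx.
case/andP=> /eqP e pP lt; have r : reach (tgt be) y by apply/reachP; exists p.
have eP := pos_arr posP be; rewrite e in eP.
have [ge|beP] : pos (tgt be) = pos (src al) + 1 \/ pos (src al) = pos (tgt be) +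
  1.
  by case: eP; [left|right].
  by rewrite (@parallel_eq _ _ posP al be) ?e // ge.
(* The path starts to the left but ends on the right, so it recrosses this gap in the opposite
   direction. *)
have [||ga [e1 e2 _]] := @reach_cross _ _ posP _ _ (pos (tgt be)) r; try lia.
by case: (@antiparallelF _ _ posP ga be); rewrite ?e; lia.
Qed.

End LineCones.

Section LinePaths.
Variables (k : fieldType) (Q : quiver) (pos : vert Q -> int).
Hypothesis posP : line_pos pos.
Implicit Types (a x y z : vert Q) (al be : arr Q) (A : pred (vert Q)).

Lemma reach_tgt_neq al y : reach (tgt al) y -> pos y != pos (src al).
Proof.
move=> r; have [e|e] := pos_arr posP al.
  by move: r; rewrite (reach_cone posP _ e) => /andP[_];
    rewrite lt_neqAle eq_sym => /andP[].
have := reach_cone (line_pos_opp posP) (al := al) y; rewrite r.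
by move=> /(_ ltac:(lia))/esym/andP[_]; lia.
Qed.

Lemma reach_tgt_eq al be y : src al = src be ->
  reach (tgt al) y -> reach (tgt be) y -> al = be.
Proof.
move=> e ra rb.
have up ga : reach (tgt ga) y -> src ga = src be ->
    pos (tgt ga) = pos (src be) + 1 -> pos (src be) < pos y.
  by move=> r <- /(reach_cone posP) h; move: r; rewrite h => /andP[].
have down ga : reach (tgt ga) y -> src ga = src be ->
    pos (src be) = pos (tgt ga) + 1 -> pos y < pos (src be).
  move=> r <- h; have := @reach_cone _ _ (line_pos_opp posP) ga y.
  by rewrite r => /(_ ltac:(lia))/esym/andP[_]; lia.
apply: (parallel_eq posP); first by rewrite e.
have := pos_arr posP al; have := pos_arr posP be; rewrite e.
have := up _ ra e; have := down _ ra e.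
have := up _ rb erefl; have := down _ rb erefl; lia.
Qed.

(** A nontrivial path does not return to its start, and its first arrow is determined by the side on
    which its end lies. *)
Lemma line_unique_paths a : unique_paths a.
Proof.
move=> x; have rP al p : is_path (tgt al) p x -> reach (tgt al) x.
  by move=> pP; apply/reachP; exists p.
move=> p; elim: p a => [|al p IHp] a [|be q] //=.
- move=> /eqP ex /andP[/eqP sb qP]; have := reach_tgt_neq (rP _ _ qP).
  by rewrite sb ex eqxx.
- move=> /andP[/eqP sa pP] /eqP ex; have := reach_tgt_neq (rP _ _ pP).
  by rewrite sa ex eqxx.
move=> /andP[/eqP sa pP] /andP[/eqP sb qP].
have e : al = be by apply: reach_tgt_eq _ (rP _ _ pP) (rP _ _ qP);
  rewrite sa sb.
by rewrite -e in qP *; rewrite (IHp _ _ pP qP).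
Qed.

Lemma projective_cone x :
  projective (thin k (fun y => reach x y && (pos x < pos y))).
Proof.
have [[al [<- alP]]|no] := pselect (exists al, src al = x /\
  pos (tgt al) = pos x + 1).
  rewrite (_ : (fun y => _) = reach (tgt al)).
    exact/projective_thin_reach/line_unique_paths.
  by apply/funext=> y; rewrite (reach_cone posP _ alP).
apply: projective_thin0 => y; apply/negP=> /andP[r lt]; apply: no.
have [be [e1 e2 _]] := reach_cross posP r (lexx _) lt.
by exists be; split=> //; apply: (pos_inj posP).
Qed.

End LinePaths.

(** Describes the right end of [A]: bounded, or containing everything from [n] on with all arrows
    there pointing outwards. The left end is treated by negating [pos]. *)
Definition tail Q (pos : vert Q -> int) (A : pred (vert Q)) : Prop :=
  exists n : int, (forall x, A x -> pos x < n) \/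
    ((forall m : int, n <= m -> exists2 x, pos x = m & A x) /\
     forall al : arr Q, n <= pos (src al) -> n <= pos (tgt al) ->
       pos (tgt al) = pos (src al) + 1).

(** * Finite presentation of thin representations from their tails *)

Section ThinFinitelyPresented.
Variables (k : fieldType) (Q : quiver) (pos : vert Q -> int).
Hypothesis posP : line_pos pos.
Implicit Types (a x y z : vert Q) (al be : arr Q) (A : pred (vert Q)).

(** The standard resolution: the cone of [x] minus its apex splits into the halves [R] and [L], both
    projective, and is the kernel of [P_x] onto the simple representation at [x]. *)
Lemma thin_simple_fp x : finitely_presented (thin k (pred1 x)).
Proof.
pose R y := reach x y && (pos x < pos y); pose L y :=
  reach x y && (- pos x < - pos y).
have [|||i [p ip]] := @thin_exact k Q (reach x) (pred1 x) (fun y => R y || L y).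
- move=> y; rewrite /R /L -andb_orr /=; case: eqP => [->|ne].
    by rewrite reach_refl.
  case: (reach x y) => //=.
  have : pos y <> pos x by move=> /(pos_inj posP).
  lia.
- by move=> y /eqP ->; rewrite /R /L; lia.
(* An arrow from [R] or [L] back into [x] would close up to a nontrivial cycle, against uniqueness
   of paths. *)
- case=> al [RL /eqP e]; have ne := reach_tgt_neq posP (reach_refl (tgt al)).
  case/orP: RL => /andP[r _].
    have := @line_unique_paths _ _ posP (src al); rewrite -e in r.
    move: r => /reachP[q qP] /(_ (src al) [::] (al :: q)) /=.
    by rewrite !eqxx qP => /(_ isT isT).
  have := @line_unique_paths _ _ posP (src al); rewrite -e in r.
  move: r => /reachP[q qP] /(_ (src al) [::] (al :: q)) /=.
  by rewrite !eqxx qP => /(_ isT isT).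
apply: projective_presentation ip.
  apply: (projective_iso (P := dsum_rep (thin k R) (thin k L))).
    apply: thin_dsum => //; first by move=> y; rewrite /R /L; lia.
      by move=> [al]; rewrite /R /L; have := pos_arr posP al; lia.
    by move=> [al]; rewrite /R /L; have := pos_arr posP al; lia.
  apply: projective_dsum; first exact: projective_cone.
  exact: (projective_cone k (line_pos_opp posP)).
exact/projective_thin_reach/(line_unique_paths posP).
Qed.

Lemma thin_level_fp A m :
  finitely_presented (thin k (fun x => A x && (pos x == m))).
Proof.
have [[x [Ax xm]]|no] := pselect (exists x, A x /\ pos x = m).
  rewrite (_ : (fun x => _) = pred1 x); first exact: thin_simple_fp.
  apply/funext => y /=; apply/andP/eqP=> [[_ /eqP ym]|->];
    last by rewrite Ax xm eqxx.
  by apply: (pos_inj posP); rewrite ym.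
apply/projective_finitely_presented/projective_thin0 => x.
by apply/negP=> /andP[Ax /eqP xm]; apply: no; exists x.
Qed.

(** At most one arrow crosses the cut, and its direction decides which of the two halves is the
    subrepresentation. *)
Lemma thin_cut_fp A m :
  finitely_presented (thin k (fun x => A x && (m <= pos x))) ->
  finitely_presented (thin k (fun x => A x && (pos x < m))) ->
  finitely_presented (thin k A).
Proof.
move=> fph fpl.
have [[al [/andP[_ s] /andP[_ t]]]|no] := pselect
  (arrow_from (fun x => A x && (pos x < m)) (fun x => A x && (m <= pos x))).
  apply: thin_ext _ _ _ fpl fph.
  - by move=> x; case: (A x) => //=; lia.
  - by move=> x; case: (A x) => //=; lia.
  - case=> be [/andP[_ s'] /andP[_ t']].
    have := pos_arr posP al; have := pos_arr posP be => beP alP.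
    by apply: (antiparallelF posP (al := al) (be := be)); lia.
apply: thin_ext _ _ no fph fpl.
- by move=> x; case: (A x) => //=; lia.
- by move=> x; case: (A x) => //=; lia.
Qed.

Lemma tail_projective A : tail pos A ->
  exists n : int, forall m : int, n <= m ->
    projective (thin k (fun x => A x && (m <= pos x))).
Proof.
(* With [n + 1], an arrow leaving position [m] to the left still has both ends at or beyond [n],
   where arrows are known to point outwards. *)
case=> n [bA|[Am right]]; [exists n|exists (n + 1)] => m nm.
  by apply: projective_thin0 => x; apply/negP=> /andP[/bA]; lia.
have [|b bm Ab] := Am m; first lia.
rewrite (_ : (fun x => _) = reach b).
  exact/projective_thin_reach/(line_unique_paths posP).
apply/funext => y; apply/andP/idP=> [[Ay my]|r].
  have [j yj] : exists j : nat, pos y = m + j by exists `|pos y - m|%N; lia.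
  elim: j y yj {Ay my} => [|j IHj] y yj.
    by have -> : y = b; [apply: (pos_inj posP); lia|apply: reach_refl].
  have [|z zj _] := Am (m + j); first lia.
  have [|al [[es et]|[es et]]] := pos_edge posP (x := z) (y := y); first lia.
    by rewrite -et; apply: reach_arr; rewrite es; apply: IHj.
  by have := right al; rewrite es et; lia.
have my : m <= pos y.
  rewrite leNgt; apply/negP=> ym.
  have [||be [e1 e2 _]] := @reach_cross _ _ (line_pos_opp posP) _ _ (- pos b) r;
    try lia.
  by have := right be; lia.
split=> //; have [|z zy Az] := Am (pos y); first lia.
by rewrite -(pos_inj posP zy).
Qed.

End ThinFinitelyPresented.

(** Both ends are projective. The left one is cut off first; what remains is built from the right
    end by adding one vertex at a time on the left. *)
Lemma tails_finitely_presented (k : fieldType) (Q : quiver) (pos : vert Q ->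
  int)
    (A : pred (vert Q)) : line_pos pos -> tail pos A ->
  tail (fun x => - pos x) A -> finitely_presented (thin k A).
Proof.
move=> posP /(tail_projective k posP)[n nP].
move=> /(tail_projective k (line_pos_opp posP))[n' n'P].
apply: (thin_cut_fp posP (m := - n' + 1)); last first.
  rewrite (_ : (fun x => _) = fun x => A x && (n' <= - pos x)).
    exact/projective_finitely_presented/n'P.
  by apply/funext=> x; congr (_ && _); lia.
(* At [Num.max n (- n' + 1)] the part to the right is already projective; each move of the bound to
   the left adds at most one simple representation. *)
have down j : finitely_presented
    (thin k (fun x => A x && (Num.max n (- n' + 1) - Posz j <= pos x))).
  elim: j => [|j IHj].
    apply: projective_finitely_presented; apply: nP; lia.
  apply: (thin_cut_fp posP (m := Num.max n (- n' + 1) - Posz j)).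
    rewrite (_ : (fun x => _) =
        fun x => A x && (Num.max n (- n' + 1) - Posz j <= pos x)) //.
    by apply/funext=> x; case: (A x) => //=; lia.
  rewrite (_ : (fun x => _) =
        fun x => A x && (pos x == Num.max n (- n' + 1) - Posz j.+1)).
    exact: thin_level_fp.
  by apply/funext=> x; case: (A x) => //=; lia.
have [j jE] : exists j : nat, Num.max n (- n' + 1) - j%:Z = - n' + 1.
  by exists (absz (Num.max n (- n' + 1) - (- n' + 1))%R); lia.
by have := down j; rewrite jE.
Qed.

(** * Walks in a line *)

Definition int_convex (J : int -> Prop) :=
  forall i j m, J i -> J j -> i <= m -> m <= j -> J m.

Lemma int_max (J : int -> Prop) (i b : int) : J i -> (forall j, J j ->
  j <= b) ->
  exists r, J r /\ forall j, J j -> j <= r.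
Proof.
move=> + Jb; have [n] : exists n : nat, b <= i + n by exists (absz (b - i)%R);
  lia.
elim: n i => [|n IHn] i bi Ji; first by exists i; split=> // j /Jb; lia.
have [[i' [Ji' ii']]|no] := pselect (exists i', J i' /\ i < i').
  by apply: IHn Ji'; lia.
by exists i; split=> // j Jj; rewrite leNgt; apply/negP=> ij; apply: no;
  exists j.
Qed.

Lemma int_min (J : int -> Prop) (i b : int) : J i -> (forall j, J j ->
  b <= j) ->
  exists r, J r /\ forall j, J j -> r <= j.
Proof.
move=> Ji Jb; have [||r [Jr rP]] := @int_max (fun m => J (- m)) (- i) (- b).
- by rewrite opprK.
- by move=> j /Jb; lia.
by exists (- r); split=> // j; rewrite -[in J _](opprK j) => /rP; lia.
Qed.

Section WalkIndexing.
Variable Q : quiver.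
Implicit Types (w : edge_product Q) (J : int -> Prop) (E : int -> edge Q).

(** A common form for all nontrivial products: [J] numbers the edges in the order of travel. The
    third clause excludes trivial walks, which have a vertex but no edge. *)
Definition indexed_by w J E : Prop :=
  [/\ forall c, edge_in w c <-> exists2 i, J i & c = E i,
      forall c d, consecutive w c d <->
        exists2 i, J i /\ J (i + 1) & c = E i /\ d = E (i + 1)
    & forall x, vert_in w x <->
        exists2 c, edge_in w c & x = edge_start c \/ x = edge_end c].

Lemma indexed_by_exists w : (exists y, w = WTriv y) \/
  exists J E, [/\ indexed_by w J E, int_convex J & exists j, J j].
Proof.
case: w => [y|c s|f|f|f]; first by left; exists y.
- right; exists (fun i : int => 0 <= i /\ i <= (size s)%:Z).
  exists (fun i => nth c (c :: s) (absz i)); split=> [|i j m|]; last 2 first.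
  + by lia.
  + by exists 0; lia.
  split=> [d|d d'|] //=; split.
  + by case=> i i_s ->; exists (Posz i) => //; lia.
  + by case=> i i_s ->; exists (absz i) => //; lia.
  + by case=> i i_s [-> ->]; exists (Posz i); [lia|rewrite addrC].
  + case=> i i_s [-> ->]; exists (absz i); first by lia.
    by rewrite (_ : absz (i + 1) = (absz i).+1) //; lia.
- right; exists (fun i : int => 0 <= i), (fun i => f (absz i)).
  split=> [|i j m|]; last 2 first.
  + by lia.
  + by exists 0; lia.
  split=> [d|d d'|] //=; split.
  + by case=> i ->; exists (Posz i).
  + by case=> i _ ->; exists (absz i).
  + by case=> i [-> ->]; exists (Posz i); [lia|rewrite addrC].
  + case=> i i_s [-> ->]; exists (absz i).
    by rewrite (_ : absz (i + 1) = (absz i).+1) //; lia.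
(* In [WRight f] the edge [f 0] is travelled last, so it gets the largest number. *)
- right; exists (fun i : int => i <= 0), (fun i => f (absz i)).
  split=> [|i j m|]; last 2 first.
  + by lia.
  + by exists 0; lia.
  split=> [d|d d'|] //=; split.
  + by case=> i ->; exists (- Posz i); [lia|congr f; lia].
  + by case=> i _ ->; exists (absz i).
  + by case=> i [-> ->]; exists (- Posz i.+1); [lia|split; congr f; lia].
  + case=> i i_s [-> ->]; exists (absz (i + 1)).
    by split; congr f; lia.
- right; exists (fun=> True), f; split=> //; last by exists 0.
  split=> [d|d d'|] //=; split.
  + by case=> i ->; exists i.
  + by case=> i _ ->; exists i.
  + by case=> i [-> ->]; exists i.
  + by case=> i _ [-> ->]; exists i.
Qed.

(** Which ends of [J] are bounded decides which of the four nontrivial constructors is used. *)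
Lemma indexed_by_build J E : int_convex J -> (exists j, J j) ->
  exists w, indexed_by w J E.
Proof.
move=> Jc [j0 Jj0].
have [[b bP]|nb] := pselect (exists b, forall j, J j -> j <= b);
have [[b' b'P]|nb'] := pselect (exists b, forall j, J j -> b <= j).
- have [r [Jr rP]] := int_max Jj0 bP; have [l [Jl lP]] := int_min Jj0 b'P.
  have JE m : J m <-> l <= m /\ m <= r.
    by split=> [Jm|[lm mr]]; [split; [apply: lP|apply: rP]|apply: Jc lm mr].
  have lr := rP _ Jl.
  pose n := absz (r - l)%R; pose s := mkseq (fun i => E (l + i.+1%:Z)) n.
  have nthE i : (i <= n)%N -> nth (E l) (E l :: s) i = E (l + i%:Z).
    by case: i => [_|i i_n] /=; [rewrite addr0|rewrite nth_mkseq].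
  exists (WFin (E l) s); split=> [c|c d|] //=; rewrite size_mkseq; split.
  + by case=> i i_n ->; exists (l + i%:Z); [apply/JE; lia|rewrite nthE //; lia].
  + case=> i /JE i_n ->; exists (absz (i - l)%R); first by lia.
    by rewrite nthE; [congr E; lia|lia].
  + case=> i i_n [-> ->]; exists (l + i%:Z); first by rewrite !JE; lia.
    by split; [rewrite nthE; [|lia]|rewrite nth_mkseq //; congr E; lia].
  + case=> i; rewrite !JE => i_n [-> ->]; exists (absz (i - l)%R); first by lia.
    by split; [rewrite nthE|rewrite nth_mkseq]; try lia; congr E; lia.
- have [r [Jr rP]] := int_max Jj0 bP.
  have JE m : J m <-> m <= r.
    split=> [/rP //|mr]; apply: contrapT => nJ; apply: nb'; exists m => j Jj.
    by rewrite leNgt; apply/negP=> jm; apply: nJ; apply: Jc Jj Jr _ mr; lia.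
  exists (WRight (fun i => E (r - i%:Z))); split=> [c|c d|] //=; split.
  + by case=> i ->; exists (r - i%:Z); [apply/JE; lia|].
  + by case=> i /JE ir ->; exists (absz (r - i)%R); congr E; lia.
  + case=> i [-> ->]; exists (r - i.+1%:Z); first by rewrite !JE; lia.
    by split=> //; congr E; lia.
  + case=> i; rewrite !JE => ir [-> ->]; exists (absz (r - (i + 1))%R).
    by split; congr E; lia.
- have [l [Jl lP]] := int_min Jj0 b'P.
  have JE m : J m <-> l <= m.
    split=> [/lP //|lm]; apply: contrapT => nJ; apply: nb; exists m => j Jj.
    by rewrite leNgt; apply/negP=> mj; apply: nJ; apply: Jc Jl Jj lm _; lia.
  exists (WLeft (fun i => E (l + i%:Z))); split=> [c|c d|] //=; split.
  + by case=> i ->; exists (l + i%:Z); [apply/JE; lia|].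
  + by case=> i /JE ir ->; exists (absz (i - l)%R); congr E; lia.
  + case=> i [-> ->]; exists (l + i%:Z); first by rewrite !JE; lia.
    by split=> //; congr E; lia.
  + case=> i; rewrite !JE => ir [-> ->]; exists (absz (i - l)%R).
    by split; congr E; lia.
- have JE m : J m.
    have [j [Jj jm]] : exists j, J j /\ j <= m.
      apply: contrapT => no; apply: nb'; exists m => j Jj.
      by rewrite leNgt; apply/negP=> jm; apply: no; exists j; split=> //; lia.
    have [j' [Jj' mj']] : exists j, J j /\ m <= j.
      apply: contrapT => no; apply: nb; exists m => j' Jj'.
      by rewrite leNgt; apply/negP=> jm'; apply: no; exists j'; split=> //; lia.
    exact: Jc Jj Jj' jm mj'.
  exists (WDouble E); split=> [c|c d|] //=; split.
  + by case=> i ->; exists i.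
  + by case=> i _ ->; exists i.
  + by case=> i [-> ->]; exists i.
  + by case=> i _ [-> ->]; exists i.
Qed.

End WalkIndexing.

Definition vert_convex Q (pos : vert Q -> int) (A : vert Q -> Prop) :=
  forall x y z, A x -> A y -> pos x <= pos z -> pos z <= pos y -> A z.

Lemma vert_convex_opp Q (pos : vert Q -> int) A :
  vert_convex pos A -> vert_convex (fun x => - pos x) A.
Proof. by move=> Ac x y z Ax Ay xz zy; apply: (Ac y x) => //; lia. Qed.

Section LineWalks.
Variables (Q : quiver) (pos : vert Q -> int).
Hypothesis posP : line_pos pos.
Implicit Types (w : edge_product Q) (x y z : vert Q) (al be : arr Q) (c d :
  edge Q).

Lemma edge_pos c : pos (edge_end c) = pos (edge_start c) + 1 \/
  pos (edge_start c) = pos (edge_end c) + 1.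
Proof. by case: c => al /=; case: (pos_arr posP al);
  [left|right|right|left]. Qed.

Lemma edge_invP c d : pos (edge_start d) = pos (edge_end c) ->
  pos (edge_end d) = pos (edge_start c) -> d = edge_inv c.
Proof.
case: c d => [al|al] [be|be] /= s e.
- by case: (antiparallelF posP (al := al) (be := be)).
- by congr inr; apply: (parallel_eq posP).
- by congr inl; apply: (parallel_eq posP).
- by case: (antiparallelF posP (al := al) (be := be)).
Qed.

Lemma edge_arr_eq c al : pos (edge_start c) = pos (src al) ->
  pos (edge_end c) = pos (tgt al) -> c = inl al.
Proof.
case: c => be /= s e; first by congr inl; apply: (parallel_eq posP).
by case: (antiparallelF posP (al := be) (be := al)).
Qed.

Lemma edge_arr_eqV c al : pos (edge_start c) = pos (tgt al) ->
  pos (edge_end c) = pos (src al) -> c = inr al.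
Proof.
case: c => be /= s e; last by congr inr; apply: (parallel_eq posP).
by case: (antiparallelF posP (al := be) (be := al)).
Qed.

(** Turning back would mean that an edge is followed by its inverse, so a reduced walk keeps its
    direction and advances by one position per edge. *)
Lemma walk_pos w J E j0 : is_walk w -> is_reduced w -> indexed_by w J E ->
  int_convex J -> J j0 ->
  pos (edge_end (E j0)) = pos (edge_start (E j0)) + 1 ->
  forall i, J i -> pos (edge_start (E i)) = pos (edge_start (E j0)) + (i - j0)
    /\
                   pos (edge_end (E i)) = pos (edge_start (E j0)) + (i - j0) +
                     1.
Proof.
move=> wW wR [_ wJ _] Jc Jj0 up0.
have link i : J i -> J (i + 1) ->
    pos (edge_end (E i)) = pos (edge_start (E (i + 1))) /\
    (pos (edge_end (E i)) = pos (edge_start (E i)) + 1 <->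
     pos (edge_end (E (i + 1))) = pos (edge_start (E (i + 1))) + 1).
  move=> Ji Ji1; have cons : consecutive w (E i) (E (i + 1)).
    by apply/wJ; exists i.
  have e := congr1 pos (wW _ _ cons); split=> //.
  have := edge_pos (E i); have := edge_pos (E (i + 1)).
  have := @edge_invP (E i) (E (i + 1)) (esym e); have := wR _ _ cons.
  move=> ninv inv h1 h2; have {}ninv :
    ~ (pos (edge_end (E (i + 1))) = pos (edge_start (E i))).
    by move/inv.
  lia.
have fwd (n : nat) : J (j0 + n%:Z) ->
    pos (edge_start (E (j0 + n%:Z))) = pos (edge_start (E j0)) + n%:Z /\
    pos (edge_end (E (j0 + n%:Z))) = pos (edge_start (E j0)) + n%:Z + 1.
  elim: n => [|n IHn] Jn; first by rewrite !addr0.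
  have Jn' : J (j0 + n%:Z) by apply: Jc Jj0 Jn _ _; lia.
  have e : j0 + n.+1%:Z = j0 + n%:Z + 1 by lia.
  by rewrite e in Jn *; have := IHn Jn'; have := link _ Jn' Jn; lia.
have bwd (n : nat) : J (j0 - n%:Z) ->
    pos (edge_start (E (j0 - n%:Z))) = pos (edge_start (E j0)) - n%:Z /\
    pos (edge_end (E (j0 - n%:Z))) = pos (edge_start (E j0)) - n%:Z + 1.
  elim: n => [|n IHn] Jn; first by rewrite !subr0.
  have Jn' : J (j0 - n%:Z) by apply: Jc Jn Jj0 _ _; lia.
  have e : j0 - n%:Z = j0 - n.+1%:Z + 1 by lia.
  have Jn'' := Jn'; rewrite e in Jn''; have := link _ Jn Jn''; rewrite -e.
  by have := IHn Jn'; have := edge_pos (E (j0 - n.+1%:Z)); lia.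
move=> i Ji; have [le|lt] := leP j0 i.
  have e : i = j0 + (absz (i - j0)%R)%:Z by lia.
  by have := fwd (absz (i - j0)%R); rewrite -e => /(_ Ji); lia.
have e : i = j0 - (absz (j0 - i)%R)%:Z by lia.
by have := bwd (absz (j0 - i)%R); rewrite -e => /(_ Ji); lia.
Qed.

(** Edge number [i] fills the gap that starts at [q + (i - j0)]. The vertices thus form an interval
    because [J] does, and an arrow between two of them belongs to the edge filling its gap. *)
Lemma walk_convex_up w J E j0 : is_walk w -> is_reduced w -> indexed_by w J E ->
  int_convex J -> J j0 ->
  pos (edge_end (E j0)) = pos (edge_start (E j0)) + 1 ->
  vert_convex pos (vert_in w) /\ forall al, full_arr w al -> arr_in w al.
Proof.
move=> wW wR wJ Jc Jj0 up0; have posE := walk_pos wW wR wJ Jc Jj0 up0.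
case: wJ => edgeE _ vertE; set q := pos (edge_start (E j0)) in posE *.
have vertP x : vert_in w x -> exists2 i, J i &
    pos x = q + (i - j0) \/ pos x = q + (i - j0) + 1.
  rewrite vertE => -[c /edgeE[i Ji ->] xE]; exists i => //.
  by have [<- <-] := posE _ Ji; case: xE => <-; [left|right].
split=> [x y z /vertP[i Ji xi] /vertP[j Jj yj] xz zy|al].
  have [lt|ge] := leP (pos z) (q + (j - j0)); last first.
    have [_ e] := posE _ Jj; apply/vertE; exists (E j); first by apply/edgeE;
      exists j.
    by right; apply: (pos_inj posP); lia.
  have [le|gt] := leP (q + (i - j0)) (pos z); last by lia.
  have Jm : J (pos z - q + j0) by apply: Jc Ji Jj _ _; lia.
  have [e _] := posE _ Jm; apply/vertE; exists (E (pos z - q + j0)).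
    by apply/edgeE; exists (pos z - q + j0).
  by left; apply: (pos_inj posP); lia.
case=> /vertP[i Ji si] /vertP[j Jj tj]; case: (pos_arr posP al) => h.
  have Jm : J (pos (src al) - q + j0).
    have [le|gt] := leP (q + (i - j0)) (q + (j - j0));
      first by apply: Jc Ji Jj _ _; lia.
    by apply: Jc Jj Ji _ _; lia.
  have [e1 e2] := posE _ Jm; left;
    rewrite -(@edge_arr_eq (E (pos (src al) - q + j0))).
  - by apply/edgeE; exists (pos (src al) - q + j0).
  - by lia.
  - by lia.
have Jm : J (pos (tgt al) - q + j0).
  have [le|gt] := leP (q + (i - j0)) (q + (j - j0));
    first by apply: Jc Ji Jj _ _; lia.
  by apply: Jc Jj Ji _ _; lia.
have [e1 e2] := posE _ Jm; right;
  rewrite -(@edge_arr_eqV (E (pos (tgt al) - q + j0))).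
- by apply/edgeE; exists (pos (tgt al) - q + j0).
- by lia.
- by lia.
Qed.

End LineWalks.

Section LineStrings.
Variables (Q : quiver) (pos : vert Q -> int).
Hypothesis posP : line_pos pos.
Implicit Types (w : edge_product Q) (x y z : vert Q) (al be : arr Q) (c d :
  edge Q).

Lemma walk_convex w : is_walk w -> is_reduced w ->
  vert_convex pos (vert_in w) /\ forall al, full_arr w al -> arr_in w al.
Proof.
move=> wW wR; have [[y wy]|[J [E [wJ Jc [j0 Jj0]]]]] := indexed_by_exists w.
  rewrite wy; split=> [x x' z -> -> xz zx|al [/= e1 e2]].
    by apply: (pos_inj posP); lia.
  by have := pos_arr posP al; rewrite e1 e2; lia.
have [up|down] := edge_pos posP (E j0).
  exact: walk_convex_up wJ Jc Jj0 up.
have [|c f] := walk_convex_up (line_pos_opp posP) wW wR wJ Jc Jj0; first by lia.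
by split=> // x y z Ax Ay xz zy; apply: (c y x) => //; lia.
Qed.

(** Edges are numbered by the position of their left end, [J] being the set of gaps with both ends
    in [A]. A single vertex needs the trivial walk. *)
Lemma walk_of_convex (A : vert Q -> Prop) : vert_convex pos A -> (exists x,
  A x) ->
  exists w, [/\ is_walk w, is_reduced w & forall x, vert_in w x <-> A x].
Proof.
move=> Ac [x0 Ax0].
have [one|/existsNP[x1 /not_implyP[Ax1 x10]]] := pselect (forall x, A x ->
  x = x0).
  by exists (WTriv x0); split=> // x /=; split=> [->|/one].
pose J m := exists x y, [/\ A x, A y, pos x = m & pos y = m + 1].
have neighb x y : A x -> A y -> pos x < pos y -> J (pos x) /\ J (pos y - 1).
  move=> Ax Ay xy.
  have [||z zx] := @pos_conv _ _ posP x y (pos x + 1); [lia..|].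
  have [||z' zy] := @pos_conv _ _ posP x y (pos y - 1); [lia..|].
  split; [exists x, z|exists z', y]; split=> //; try lia; apply: (Ac x y) => //;
    lia.
have Jne x : A x -> J (pos x) \/ J (pos x - 1).
  move=> Ax; have [y [Ay yx]] : exists y, A y /\ pos y <> pos x.
    have [e|ne] := eqVneq x x0.
      by exists x1; split=> // /(pos_inj posP); rewrite e.
    by exists x0; split=> // /(pos_inj posP) e; rewrite e eqxx in ne.
  have [lt|ge] := ltP (pos x) (pos y); first by left; case: (neighb x y).
  by right; case: (neighb y x) => //; lia.
have Jc : int_convex J.
  move=> i j m [x [_ [Ax _ xi _]]] [_ [y [_ Ay _ yj]]] im mj.
  have [||z zm] := @pos_conv _ _ posP x y m; [lia..|].
  have [||z' zm'] := @pos_conv _ _ posP x y (m + 1); [lia..|].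
  by exists z, z'; split=> //; apply: (Ac x y) => //; lia.
have edgeJ m : J m -> exists c : edge Q, pos (edge_start c) = m /\
  pos (edge_end c) = m + 1.
  case=> x [y [_ _ <- yx]]; have [al alP] := pos_edge posP yx.
  by case: alP => [[s t]|[s t]]; [exists (inl al)|exists (inr al)];
    rewrite /= s t.
have Jex : exists j, J j by case: (Jne _ Ax0); eexists; eassumption.
(* A default value for the edge function outside [J]. *)
have [c0 _] : exists c : edge Q, True by case: Jex => j /edgeJ[c _]; exists c.
have /choice[E EP] : forall m, exists c : edge Q, J m ->
    pos (edge_start c) = m /\ pos (edge_end c) = m + 1.
  move=> m; have [/edgeJ[c cP]|nJ] := pselect (J m); first by exists c.
  by exists c0.
have [w [edgeE consE vertE]] := indexed_by_build E Jc Jex.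
exists w; split.
- move=> c d /consE[i [Ji Ji1] [-> ->]].
  apply: (pos_inj posP); have := EP _ Ji; have := EP _ Ji1; lia.
- move=> c d /consE[i [Ji Ji1] [-> ->]] e.
  have := EP _ Ji; have := EP _ Ji1; rewrite e.
  by case: (E i) => al /=; lia.
move=> x; rewrite vertE; split=> [[c /edgeE[i Ji ->]]|Ax].
  have [s t] := EP _ Ji; case: Ji => y [z [Ay Az yi zi]].
  case=> ->; [rewrite (_ : edge_start _ = y) //|rewrite (_ :
    edge_end _ = z) //];
  apply: (pos_inj posP); lia.
case: (Jne _ Ax) => Jx; eexists; try (by apply/edgeE; eexists; first exact: Jx).
  by left; apply: (pos_inj posP); case: (EP _ Jx); lia.
by right; apply: (pos_inj posP); case: (EP _ Jx); lia.
Qed.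

End LineStrings.

(** * Strings without left infinite path and the tail condition *)

Section StringTails.
Variable Q : quiver.
Implicit Types (w : edge_product Q) (x y z : vert Q) (al be : arr Q).

Definition walk_support w : pred (vert Q) := fun x => `[< vert_in w x >].

Lemma pos_bounded pos (s : seq (vert Q)) :
  exists N : int, forall x, x \in s -> pos x <= N.
Proof.
elim: s => [|y s [N NP]]; first by exists 0.
exists (Num.max N (pos y)) => x; rewrite inE => /orP[/eqP ->|/NP]; lia.
Qed.

Lemma pos_finite pos (n : nat) (b : int) : line_pos pos ->
  exists s : seq (vert Q), forall x, b <= pos x -> pos x < b + n -> x \in s.
Proof.
move=> posP; elim: n => [|n [s sP]]; first by exists [::]; lia.
have [[y yb]|no] := pselect (exists y, pos y = b + n).
  exists (y :: s) => x bx xb; rewrite inE.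
  have [e|ne] := eqVneq x y => //=; apply: sP => //.
  have : pos x <> pos y by move=> /(pos_inj posP) e; rewrite e eqxx in ne.
  lia.
exists s => x bx xb; apply: sP => //.
have : pos x <> b + n by move=> e; apply: no; exists x.
lia.
Qed.

(** On an unbounded side, no vertex far out is a source, so a single inward arrow there could be
    continued backwards forever, giving a left infinite path. *)
Lemma string_tail pos w : line_pos pos -> is_string w ->
  ~ has_left_infinite_path w -> tail pos (walk_support w).
Proof.
move=> posP [wW wR [x0 x0P] [s sP]] noleft.
have [Ac _] := walk_convex posP wW wR.
have Ax0 : vert_in w x0 by case: x0P => -[].
have [N NP] := pos_bounded pos s.
have [[b bP]|nb] := pselect (exists b, forall x, vert_in w x -> pos x < b).
  by exists b; left=> x /asboolP/bP.
have big m : pos x0 <= m -> exists2 x, pos x = m & vert_in w x.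
  move=> xm; have [y [Ay my]] : exists y, vert_in w y /\ m <= pos y.
    apply: contrapT => no; apply: nb; exists m => y Ay.
    by rewrite ltNge; apply/negP=> my; apply: no; exists y.
  have [z zm] := pos_conv posP xm my.
  by exists z => //; apply: Ac Ax0 Ay _ _; lia.
have Abig x : pos x0 <= pos x -> vert_in w x.
  by move=> /big[y /(pos_inj posP) ->].
exists (Num.max N (pos x0) + 1); right; split=> [m mN|al sal tal].
  have [|x xm Ax] := big m; first lia.
  by exists x => //; apply/asboolP.
case: (pos_arr posP al) => // alP; case: noleft.
have full be : pos x0 <= pos (src be) -> pos x0 <= pos (tgt be) ->
  full_arr w be.
  by move=> /Abig ? /Abig.
(* Since [src be] is not a source, some arrow of Q(w) ends there; it cannot be antiparallel to [be],
   so it comes from further right. *)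
have /choice[p pP] : forall j : nat, exists be,
    pos (tgt be) = pos (tgt al) + j%:Z /\
      pos (src be) = pos (tgt al) + j%:Z + 1.
  elim=> [|j [be [tbe sbe]]]; first by exists al; lia.
  have Ay : vert_in w (src be) by apply: Abig; lia.
  have nsource : ~ is_source w (src be).
    by move=> so; have := NP _ (sP _ (or_intror so)); lia.
  have [ga [gaf tga]] : exists ga, full_arr w ga /\ tgt ga = src be.
    apply: contrapT => no; apply: nsource; split=> // ga gaf tga.
    by apply: no; exists ga.
  exists ga; rewrite tga; have gaP := pos_arr posP ga; rewrite tga in gaP.
  split; first lia.
  case: gaP => gaP; last lia.
  by case: (antiparallelF posP (al := ga) (be := be)); rewrite ?tga; lia.
exists p => i; have [ti si] := pP i; have [ti' si'] := pP i.+1.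
by split; [apply: full; lia|apply: (pos_inj posP); lia].
Qed.

(** Without antiparallel arrows, each further arrow also points left and starts one position further
    right; beyond [n] this contradicts either form of the tail. *)
Lemma tail_no_leftward_path pos (A : pred (vert Q)) (p : nat -> arr Q) :
  line_pos pos -> tail pos A ->
  (forall i, (A (src (p i)) /\ A (tgt (p i))) /\ tgt (p i.+1) = src (p i)) ->
  pos (src (p 0%N)) = pos (tgt (p 0%N)) + 1 -> False.
Proof.
move=> posP [n nP] pP p0.
have pE (i : nat) : pos (src (p i)) = pos (tgt (p i)) + 1 /\
    pos (src (p i)) = pos (src (p 0%N)) + i%:Z.
  elim: i => [|i IHi]; first by lia.
  have [_ e] := pP i; have := pos_arr posP (p i.+1); rewrite e.
  case=> h; last by lia.
  case: (antiparallelF posP (al := p i.+1) (be := p i)); last by rewrite e.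
  lia.
have [i iE] : exists i : nat, n < pos (src (p 0%N)) + i%:Z.
  by exists (absz (n - pos (src (p 0%N)) + 1)%R); lia.
have [[s t] _] := pP i; have [e1 e2] := pE i.
case: nP => [b|[_ right]].
  by have := b _ s; lia.
by have := right (p i); lia.
Qed.

(** If the tail is unbounded, every vertex beyond [n] receives an arrow from its left neighbour and
    sends one to its right neighbour, hence is neither a sink nor a source. *)
Lemma tail_sink_source_bounded pos w : line_pos pos ->
  tail pos (walk_support w) ->
  exists N : int, forall x, is_sink w x \/ is_source w x -> pos x <= N.
Proof.
move=> posP [n [b|[An right]]].
  exists n => x xP; have /asboolP/b : vert_in w x by case: xP => -[].
  lia.
exists n => x xP; rewrite leNgt; apply/negP => nx.
have [|y yx /asboolP Ay] := An (pos x - 1); first lia.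
have [|z zx /asboolP Az] := An (pos x + 1); first lia.
have Ax : vert_in w x by case: xP => -[].
have [|al [[s t]|[s t]]] := pos_edge posP (x := y) (y := x); first lia;
  last first.
  by have := right al; rewrite s t; lia.
have [|be [[s' t']|[s' t']]] := pos_edge posP (x := x) (y := z); first lia;
  last first.
  by have := right be; rewrite s' t'; lia.
case: xP => -[_ xP]; first by apply: (xP be) => //; rewrite /full_arr s' t'.
by apply: (xP al) => //; rewrite /full_arr s t.
Qed.

Lemma tails_string pos w : line_pos pos -> is_walk w -> is_reduced w ->
  (exists x, vert_in w x) -> tail pos (walk_support w) ->
    tail (fun x => - pos x) (walk_support w) ->
  is_string w /\ ~ has_left_infinite_path w.
Proof.
move=> posP wW wR [x0 Ax0] tr tl; have posN := line_pos_opp posP.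
have noleft : ~ has_left_infinite_path w.
  case=> p pP.
  have pA i : (walk_support w (src (p i)) /\ walk_support w (tgt (p i))) /\
    tgt (p i.+1) = src (p i).
    by have [[? ?] ?] := pP i; split=> //; split; apply/asboolP.
  have [h|h] := pos_arr posP (p 0%N).
    by apply: (tail_no_leftward_path posN tl pA); lia.
  exact: (tail_no_leftward_path posP tr pA).
split=> //; split=> //.
  (* Without any source, every vertex is the target of an arrow of Q(w), and iterating predecessors
     gives a left infinite path. *)
  apply: contrapT => no; apply: noleft.
  have pred_ x : vert_in w x -> exists al, full_arr w al /\ tgt al = x.
    move=> Ax; apply: contrapT => no'; apply: no; exists x; right;
      split=> // al alf e.
    by apply: no'; exists al.
  have /choice[nxt nxtP] : forall al, exists be, full_arr w al ->
      full_arr w be /\ tgt be = src al.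
    move=> al; have [[s t]|n] := pselect (full_arr w al); last by exists al.
    by have [be beP] := pred_ _ s; exists be.
  have [al0 [al0f _]] := pred_ _ Ax0.
  exists (fun i => iter i nxt al0) => i.
  have f j : full_arr w (iter j nxt al0).
    by elim: j => //= j IHj; case: (nxtP _ IHj).
  by split=> //=; case: (nxtP _ (f i)).
have [N NP] := tail_sink_source_bounded posP tr.
have [N' N'P] := tail_sink_source_bounded posN tl.
have [s sP] := pos_finite (absz (N + N' + 1)%R) (- N') posP.
exists s => x xP; have := NP _ xP; have := N'P _ xP => h1 h2.
by apply: sP; lia.
Qed.

(** Every arrow between vertices of the walk occurs in it, so the maps agree; the spaces are
    literally the same and identities serve as isomorphism. *)
Lemma string_rep_iso (k : fieldType) (pos : vert Q -> int) w : line_pos pos ->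
  is_walk w -> is_reduced w ->
  rep_iso (string_rep k w) (thin k (walk_support w)).
Proof.
move=> posP wW wR; have [_ full] := walk_convex posP wW wR.
have E al (u : string_space k w (src al)) :
    string_map k w al u = line_id k (walk_support w (src al)) (walk_support w
      (tgt al)) u.
  rewrite /string_map; case: asboolP => // na; move: u.
  rewrite /string_space -/(walk_support w (src al)) -/(walk_support w (tgt al)).
  have : ~~ (walk_support w (src al) && walk_support w (tgt al)).
    by apply/negP => /andP[/asboolP s /asboolP t]; apply: na; apply: full.
  by case: (walk_support w (src al)); case: (walk_support w (tgt al)).
have F : forall al u,
  rep_map (string_rep k w) al u = rep_map (thin k (walk_support w)) al u.
  exact: E.
exists (@RepHom k Q (string_rep k w) (thin k (walk_support w)) (fun x => idfun)
  F).
have G : forall al u,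
  rep_map (thin k (walk_support w)) al u = rep_map (string_rep k w) al u.
  by move=> al u; rewrite F.
by exists (@RepHom k Q (thin k (walk_support w)) (string_rep k w) (fun x =>
  idfun) G).
Qed.

End StringTails.

(** * Splitting off a thin summand *)

Section MatrixLemmas.
Variable k : fieldType.

(** The column space of [A] is cut out by its left kernel: the rows of [A *m pinvmx A - 1%:M] lie in
    that kernel, so [pinvmx A *m c] is a solution. *)
Lemma colspace_solve m n (A : 'M[k]_(m, n)) (c : 'cV_m) :
  kermx A *m c = 0 -> exists z, A *m z = c.
Proof.
move=> kc; exists (pinvmx A *m c); apply/eqP; rewrite -subr_eq0 mulmxA.
rewrite -{2}[c]mul1mx -mulmxBl.
have /submxP[D ->] : (A *m pinvmx A - 1%:M <= kermx A)%MS.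
  by apply/sub_kermxP; rewrite mulmxBl mul1mx mulmxKpV ?subrr.
by rewrite -mulmxA kc mulmx0.
Qed.

(** The columns of [cokermx G] vanish on [G] and one of them is nonzero at [v]; the form is that
    column, rescaled. *)
Lemma separate_row m n (v : 'rV[k]_n) (G : 'M_(m, n)) : ~~ (v <= G)%MS ->
  exists c : 'cV_n, G *m c = 0 /\ v *m c = 1%:M.
Proof.
rewrite submxE => /rV0Pn[j jP]; set e := delta_mx j 0 : 'cV[k]_n.
exists (cokermx G *m (((v *m cokermx G) 0 j)^-1 *: e)); split.
  by rewrite mulmxA mulmx_coker mul0mx.
rewrite mulmxA; move: (v *m _) jP => r jP.
rewrite -scalemxAr -colE; apply/rowP=> i.
by rewrite ord1 mxE [col _ _ _ _]mxE mulVf // mxE.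
Qed.

End MatrixLemmas.

(** * Matrix representations and the complement of a thin summand *)

Section MatrixReps.
Variables (k : fieldType) (Q : quiver) (d : vert Q -> nat).
Variable B : forall al : arr Q, 'M[k]_(d (src al), d (tgt al)).
Arguments B : clear implicits.
Implicit Types (x y z : vert Q) (al be : arr Q) (A : pred (vert Q)).
Implicit Types (u : forall x, 'rV[k]_(d x)) (c : forall x, 'cV[k]_(d x)).

(** Matrices with [r] rows amount to [r] copies of the representation on row vectors; [r = d b]
    makes it possible to transport the identity matrix from a vertex [b]. *)
Definition mxrep (r : nat) : rep k Q :=
  @Rep k Q (fun x => 'M[k]_(r, d x)) (fun al => mulmxr (B al)).

(* [u] is a homomorphism from the thin representation of [A] to [mxrep 1], and
   [c] one in the other direction, with composite the identity. *)
Definition splitting A u c : Prop :=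
  [/\ forall x, ~~ A x -> u x = 0 /\ c x = 0,
      forall al, A (src al) -> u (src al) *m B al = u (tgt al),
      forall al, A (tgt al) -> B al *m c (tgt al) = c (src al)
    & forall x, A x -> u x *m c x = 1%:M].

Section Complement.
Variables (A : pred (vert Q)) (u : forall x, 'rV[k]_(d x)) (c : forall x,
  'cV[k]_(d x)).
Hypothesis uc : splitting A u c.

Let K x := row_base (kermx (c x)).
Let P x := pinvmx (K x).

(** The kernel of the forms [c], in the coordinates of the row basis [K x]; on that kernel [P x]
    inverts the inclusion. *)
Definition complement : rep k Q :=
  @Rep k Q (fun x => 'rV[k]_(\rank (kermx (c x))))
    (fun al => mulmxr (K (src al) *m B al *m P (tgt al))).

Lemma ker_incl_retract x (w : 'rV[k]_(\rank (kermx (c x)))) :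
  w *m K x *m P x = w.
Proof. by rewrite -mulmxA mulmxVp ?row_base_free ?mulmx1. Qed.

Lemma ker_retract_incl x (w : 'rV[k]_(d x)) : w *m c x = 0 ->
  w *m P x *m K x = w.
Proof. by move=> wc; rewrite mulmxKpV // eq_row_base; apply/sub_kermxP. Qed.

Lemma ker_incl_form x (w : 'rV[k]_(\rank (kermx (c x)))) : w *m K x *m c x = 0.
Proof. by apply/sub_kermxP; rewrite -(eq_row_base (kermx (c x))) submxMl. Qed.

Lemma coef_comm al (m : 'rV[k]_(d (src al))) :
  m *m B al *m c (tgt al) = if A (tgt al) then m *m c (src al) else 0.
Proof.
case: uc => uc0 _ cC _; case: ifP => At; first by rewrite -mulmxA cC.
by have [_ ->] := uc0 (tgt al) (negbT At); rewrite mulmx0.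
Qed.

Lemma kernel_stable al (w : 'rV[k]_(d (src al))) :
  w *m c (src al) = 0 -> w *m B al *m c (tgt al) = 0.
Proof. by rewrite coef_comm => ->; case: ifP. Qed.

Lemma scalar_mx11 (a : 'M[k]_1) n (w : 'rV[k]_n) : a *m w = a 0 0 *: w.
Proof. by rewrite {1}[a]mx11_scalar mul_scalar_mx. Qed.

Definition proj_ker x (m : 'rV[k]_(d x)) := m - m *m c x *m u x.

Lemma proj_kerP x m : proj_ker m *m c x = 0.
Proof.
case: uc => uc0 _ _ uc1; rewrite /proj_ker mulmxBl -[m *m _ *m _ *m _]mulmxA.
have [Ax|Ax] := boolP (A x); first by rewrite uc1 // mulmx1 subrr.
by have [_ ->] := uc0 x Ax; rewrite !mulmx0 subrr.
Qed.

Lemma splitting_map al : A (src al) ->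
  rep_map (mxrep 1) al (u (src al)) = u (tgt al).
Proof. by case: uc => _ uC _ _ /uC. Qed.

Lemma splitting_eq0 x : ~~ A x -> u x = 0.
Proof. by case: uc => uc0 _ _ _ /uc0[]. Qed.

Definition to_thin : rep_hom (mxrep 1) (thin k A).
Proof.
apply: (@hom_of k Q (mxrep 1) (thin k A)
    (fun x m => (m *m c x) 0 0 *: thin_one k A x)) => [x a m n|al m].
  by rewrite mulmxDl -scalemxAl !mxE scalerDl scalerA.
rewrite linearZ; have /orP[At|At] := orbN (A (tgt al)); last first.
  by rewrite [LHS](thin_eq0 _ At) [RHS](thin_eq0 _ At).
rewrite [rep_map (mxrep 1) al m]/(m *m B al) coef_comm At.
have /orP[As|As] := orbN (A (src al)).
  by rewrite (thin_map _ As At) thin_coef_one // scale1r.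
case: uc => uc0 _ _ _; have [_ ->] := uc0 _ As.
by rewrite mulmx0 mxE scale0r [RHS]scale0r.
Defined.

Definition of_thin : rep_hom (thin k A) (mxrep 1) := hom_thin (M :=
  mxrep 1) splitting_eq0 splitting_map.

Definition to_complement : rep_hom (mxrep 1) complement.
Proof.
apply: (@hom_of k Q (mxrep 1) complement (fun x m => proj_ker m *m P x))
  => [x a m n|al m].
  rewrite scalemxAl -mulmxDl /proj_ker; congr (_ *m _).
  by rewrite !mulmxDl -!scalemxAl scalerBr opprD addrACA.
rewrite [LHS]/= [RHS]/= 2!(mulmxA (proj_ker m *m P (src al))) ker_retract_incl
  ?proj_kerP //.
congr (_ *m _).
rewrite /proj_ker mulmxBl coef_comm; congr (_ - _).
case: uc => uc0 uC cC uc1.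
have [As|As] := boolP (A (src al)); last first.
  have [-> ->] := uc0 _ As; rewrite !mulmx0 mul0mx.
  by case: ifP; rewrite mul0mx.
rewrite -[RHS]mulmxA uC //; case: ifP => // At.
by rewrite splitting_eq0 ?At // mulmx0 mulmx0.
Defined.

Definition of_complement : rep_hom complement (mxrep 1).
Proof.
apply: (@hom_of k Q complement (mxrep 1) (fun x w => w *m K x)) => [x a m n|al
  w].
  by rewrite mulmxDl scalemxAl.
rewrite [LHS]/= [RHS]/= 2!(mulmxA w) ker_retract_incl //; apply: kernel_stable;
  exact: ker_incl_form.
Defined.

Lemma splitting_iso : rep_iso (mxrep 1) (dsum_rep (thin k A) complement).
Proof.
exists (hom_pair to_thin to_complement),
  (hom_copair of_thin of_complement) => x.
have toE (m : mxrep 1 x) : to_thin x m = (m *m c x) 0 0 *: thin_one k A x by [].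
have tocE (m : mxrep 1 x) : to_complement x m = proj_ker m *m P x by [].
have ofE (t : thin k A x) : of_thin x t = thin_coef t *: u x by [].
have ofcE (w : complement x) : of_complement x w = w *m K x by [].
case: uc => uc0 uC cC uc1; split=> [m|[t w]].
  transitivity (of_thin x (to_thin x m) + of_complement x (to_complement x m))
    => //.
  rewrite toE tocE ofE ofcE ker_retract_incl ?proj_kerP //.
  suff : thin_coef ((m *m c x) 0 0 *: thin_one k A x) *: u x + proj_ker m = m by
    [].
  have [Ax|Ax] := boolP (A x); last first.
    by rewrite /proj_ker splitting_eq0 // mulmx0 subr0 scaler0 add0r.
  rewrite thin_coefZ thin_coef_one // mulr1 /proj_ker.
  by rewrite scalar_mx11 addrC subrK.
pose m : 'rV[k]_(d x) := thin_coef t *: u x + w *m K x.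
suff [e1 e2] : (m *m c x) 0 0 *: thin_one k A x = t /\ proj_ker m *m P x = w.
  exact: (congr2 pair e1 e2).
have [Ax|Ax] := boolP (A x); last first.
  have [u0x c0x] := uc0 x Ax;
    rewrite /m /proj_ker u0x mulmx0 subr0 scaler0 add0r ker_incl_retract.
  by split=> //; rewrite [LHS](thin_eq0 _ Ax) [RHS](thin_eq0 _ Ax).
have mc : m *m c x = (thin_coef t)%:M.
  by rewrite mulmxDl ker_incl_form addr0 -scalemxAl uc1 // scalemx1.
rewrite /proj_ker mc mul_scalar_mx /m [X in X *: _]mxE eqxx thin_coefK.
by rewrite addrAC subrr add0r ker_incl_retract.
Qed.

Lemma complement_locally_finite_dim : locally_finite_dim complement.
Proof. by move=> x; exists (\rank (kermx (c x))), idfun; exists idfun. Qed.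

End Complement.

End MatrixReps.

Lemma mxrep_exists (k : fieldType) (Q : quiver) (M : rep k Q) :
  locally_finite_dim M ->
  exists d (B : forall al : arr Q, 'M[k]_(d (src al), d (tgt al))),
    rep_iso M (mxrep B 1).
Proof.
move=> Mf; pose d x := projT1 (cid (Mf x)).
pose f x : {linear M x -> 'rV[k]_(d x)} := projT1 (cid (projT2 (cid (Mf x)))).
have gP x : exists g : 'rV[k]_(d x) -> M x, cancel (f x) g /\ cancel g (f x).
  have [g fK gK] : bijective (f x) := projT2 (cid (projT2 (cid (Mf x)))).
  by exists g.
pose g x := projT1 (cid (gP x)).
have fK x : cancel (f x) (g x) by have [] := projT2 (cid (gP x)).
have gK x : cancel (g x) (f x) by have [] := projT2 (cid (gP x)).
have gL x : linear (g x).
  by move=> a u v; apply: (can_inj (fK x)); rewrite linearP !gK.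
pose h al : {linear 'rV[k]_(d (src al)) -> 'rV[k]_(d (tgt al))} :=
  f (tgt al) \o rep_map M al \o linear_of (gL (src al)).
exists d, (fun al => lin1_mx (h al)).
set N := mxrep _ 1.
have fC al u : f (tgt al) (rep_map M al u) = rep_map N al (f (src al) u).
  rewrite [RHS](mul_rV_lin1 (h al)); congr (f _ (rep_map M al _)).
  exact: esym (fK _ u).
have gC al (u : N (src al)) :
  g (tgt al) (rep_map N al u) = rep_map M al (g (src al) u).
  by apply: (can_inj (fK _)); rewrite fC !gK.
exists (@RepHom k Q M N f fC), (@hom_of k Q N M g gL gC) => x.
by split=> u /=; rewrite ?fK ?gK.
Qed.

(** * Filtrations by vectors and forms that extend to one side *)

Section HalfSplitting.
Variables (k : fieldType) (Q : quiver) (d : vert Q -> nat).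
Variable B : forall al : arr Q, 'M[k]_(d (src al), d (tgt al)).
Arguments B : clear implicits.
Variable pos : vert Q -> int.
Hypothesis posP : line_pos pos.
Implicit Types (x y z : vert Q) (al be : arr Q) (A : pred (vert Q)).
Implicit Types (u : forall x, 'rV[k]_(d x)) (c : forall x, 'cV[k]_(d x)).

(** The conditions of [splitting] on the part of the quiver at positions up to [n]; negating [pos]
    gives the other side. *)
Definition half_splitting (n : int) A u c : Prop :=
  [/\ forall x, A x -> pos x <= n, forall x, ~~ A x -> u x = 0 /\ c x = 0,
      forall al, pos (src al) <= n -> pos (tgt al) <= n ->
        (A (src al) -> u (src al) *m B al = u (tgt al)) /\
        (A (tgt al) -> B al *m c (tgt al) = c (src al))
    & forall x, A x -> u x *m c x = 1%:M].

Definition extends_to x (v : 'rV[k]_(d x)) (e : 'cV[k]_(d x)) : Prop :=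
  exists A u c, [/\ half_splitting (pos x) A u c, vert_convex pos A,
    A x, u x = v & c x = e].

(* The terms [F i] need not be nested, although those constructed here are. *)
Definition filtered x : Prop :=
  exists (F : nat -> 'M[k]_(d x)) (N : nat), [/\ F 0%N = 0, row_full (F N)
    & forall i (v : 'rV_(d x)) (e : 'cV_(d x)), (i < N)%N -> (v <= F i.+1)%MS ->
        F i *m e = 0 -> v *m e = 1%:M -> extends_to v e].

Lemma filtered_dim0 x : d x = 0%N -> filtered x.
Proof.
move=> dx; exists (fun=> 0), 0%N; split=> //.
by rewrite /row_full mxrank0 dx.
Qed.

(** The only arrow between [x] and the part up to [y] is [al], so it is the only arrow along which
    compatibility remains to be checked. *)
Lemma half_splitting_step al x y A u c (v : 'rV_(d x)) (e : 'cV_(d x)) :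
  joins al y x -> pos x = pos y + 1 -> half_splitting (pos y) A u c ->
  let A' := fun z => A z || (z == x) in
  let u' := dfwith u v in let c' := dfwith c e in
  (A' (src al) -> u' (src al) *m B al = u' (tgt al)) ->
  (A' (tgt al) -> B al *m c' (tgt al) = c' (src al)) -> v *m e = 1%:M ->
  half_splitting (pos x) A' u' c'.
Proof.
move=> alP xy [An A0 AC A1] A' u' c' uC cC ve.
have xlow z : pos z <= pos y -> x != z.
  by move=> zy; apply/eqP=> e'; move: zy; rewrite -e'; lia.
split.
- by move=> z /orP[/An|/eqP ->]; lia.
- move=> z; rewrite negb_or => /andP[/A0[uz cz] zx].
  by rewrite /u' /c' !dfwith_out // eq_sym.
- move=> be sx tx.
  have low z : pos z <= pos x -> z = x \/ pos z <= pos y.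
    move=> zx; have [zy|yz] := leP (pos z) (pos y); first by right.
    by left; apply: (pos_inj posP); lia.
  have [[sy ty]|->] : (pos (src be) <= pos y /\
    pos (tgt be) <= pos y) \/ be = al.
  + have beP := pos_arr posP be.
    case: (low _ sx) (low _ tx) => [sb|sb] [tb|tb]; last by left.
    * by move: beP; rewrite sb tb; lia.
    * right; apply: (pos_uniq posP).
      have tby : tgt be = y by apply: (pos_inj posP); move: beP; rewrite sb;
        lia.
      by rewrite /joins sb tby; case: alP => [[-> ->]|[-> ->]]; [right|left].
    * right; apply: (pos_uniq posP).
      have sby : src be = y by apply: (pos_inj posP); move: beP; rewrite tb;
        lia.
      by rewrite /joins tb sby; case: alP => [[-> ->]|[-> ->]]; [left|right].
  + have [uC' cC'] := AC be sy ty.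
    have [xs xt] := (xlow _ sy, xlow _ ty).
    by rewrite /A' /u' /c' !dfwith_out // ![_ == x]eq_sym (negPf xs) (negPf xt)
      !orbF.
  + by split.
- move=> z /orP[Az|/eqP ->].
    by rewrite /u' /c' !dfwith_out ?A1 //; apply: xlow; apply: An.
  by rewrite /u' /c' !dfwith_in.
Qed.

Lemma half_splitting0 n : half_splitting n pred0 (fun=> 0) (fun=> 0).
Proof. by split. Qed.

Lemma vert_convex_add A x y : vert_convex pos A -> (forall z, A z ->
  pos z <= pos y) ->
  pos x = pos y + 1 -> A y -> vert_convex pos (fun z => A z || (z == x)).
Proof.
move=> Ac An xy Ay z z' t /orP[Az|/eqP zx] + zt tz'.
  case/orP=> [Az'|/eqP z'x]; first by apply/orP; left; apply: (Ac z z').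
  have [ty|yt] := leP (pos t) (pos y); first by apply/orP; left;
    apply: (Ac z y).
  by apply/orP; right; apply/eqP/(pos_inj posP); rewrite -z'x; move: tz';
    rewrite z'x; lia.
rewrite zx in zt; case/orP=> [/An|/eqP z'x]; first lia.
by apply/orP; right; apply/eqP/(pos_inj posP); rewrite z'x in tz'; lia.
Qed.

Lemma vert_convex1 x : vert_convex pos (fun z => pred0 z || (z == x)).
Proof. by move=> z z' t /eqP -> /eqP -> xt tx; apply/eqP/(pos_inj posP);
  lia. Qed.

(** The filtration is pushed forward along [B al] and completed by the whole space. Steps inside the
    image prolong intervals ending at [src al]; the last step starts a new interval at [tgt al]. *)
Lemma filtered_up al : pos (tgt al) = pos (src al) + 1 ->
  filtered (src al) -> filtered (tgt al).
Proof.
move=> up [F [N [F0 FN FP]]].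
have st : tgt al != src al by apply/eqP=> e; rewrite e in up; lia.
have jal : joins al (src al) (tgt al) by left.
exists (fun i => if (i <= N)%N then genmx (F i *m B al) else 1%:M), N.+1.
split=> [||i v e iN vF Fe ve].
- by rewrite F0 mul0mx genmx0.
- by rewrite ltnn row_full_unit unitmx1.
have {}Fe : F i *m B al *m e = 0.
  rewrite -ltnS iN in Fe; apply/sub_kermxP; rewrite -genmxE; exact/sub_kermxP.
have [ltiN|] := ltnP i N; last first.
  move=> leNi; have iNE : i = N by apply/eqP; rewrite eqn_leq -ltnS iN.
  (* [F N] is everything, so [e] vanishes on the whole image of [B al], and the interval consisting
     of [tgt al] alone works. *)
  have Be : B al *m e = 0.
    rewrite iNE -mulmxA in Fe; apply: (row_full_inj FN).
    by rewrite Fe mulmx0.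
  eexists _, _, _; split.
  + apply: (half_splitting_step jal up (half_splitting0 _) _ _ ve).
      by rewrite /= eq_sym (negPf st).
    by rewrite dfwith_in dfwith_out.
  + exact: vert_convex1.
  + by rewrite /= eqxx.
  + by rewrite dfwith_in.
  + by rewrite dfwith_in.
rewrite ltiN genmxE in vF; have /submxP[w vE] := vF.
rewrite mulmxA in vE.
(* The vector is pulled back to a preimage in [F i.+1], and the form is composed with [B al]. *)
have [|||A [u [c [Auc Ac Ay uy cy]]]] := FP i (w *m F i.+1) (B al *m e) ltiN.
- exact: submxMl.
- by rewrite mulmxA.
- by rewrite mulmxA -vE.
have [An A0 AC A1] := Auc.
eexists _, _, _; split.
+ apply: (half_splitting_step jal up Auc _ _ ve).
    by move=> _; rewrite dfwith_in dfwith_out // uy -vE.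
  by move=> _; rewrite dfwith_in dfwith_out // cy.
+ exact: vert_convex_add Ac An up Ay.
+ by rewrite /= eqxx orbT.
+ by rewrite dfwith_in.
+ by rewrite dfwith_in.
Qed.

(** Dually, preimages under [B al] are taken, preceded by 0. The first step, the kernel of [B al],
    starts new intervals at [src al]; the others prolong intervals. *)
Lemma filtered_down al : pos (src al) = pos (tgt al) + 1 ->
  filtered (tgt al) -> filtered (src al).
Proof.
move=> up [F [N [F0 FN FP]]].
have st : src al != tgt al by apply/eqP=> e; rewrite e in up; lia.
have jal : joins al (tgt al) (src al) by right.
exists (fun i => if i is j.+1 then kermx (B al *m cokermx (F j)) else 0), N.+1.
split=> [//||i v e iN /sub_kermxP vF Fe ve].
  have /eqP -> : cokermx (F N) == 0 by rewrite cokermx_eq0.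
  by rewrite mulmx0 -sub1mx; apply/sub_kermxP; rewrite mulmx0.
case: i iN vF Fe => [|i] iN vF Fe.
  have vB : v *m B al = 0.
    apply/eqP; rewrite -submx0 -(F0) submxE -mulmxA; exact/eqP.
  eexists _, _, _; split.
  + apply: (half_splitting_step jal up (half_splitting0 _) _ _ ve).
      by rewrite dfwith_in dfwith_out.
    by rewrite /= eq_sym (negPf st).
  + exact: vert_convex1.
  + by rewrite /= eqxx.
  + by rewrite dfwith_in.
  + by rewrite dfwith_in.
(* [e] vanishes on the preimage of [F i], so it factors through [B al] followed by the quotient by
   [F i]; the factor is a form at [tgt al] vanishing on [F i]. *)
have [z zE] := colspace_solve Fe; rewrite -mulmxA in zE.
have [|||A [u [c [Auc Ac Ay uy cy]]]] :=
  FP i (v *m B al) (cokermx (F i) *m z) iN.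
- by rewrite submxE -mulmxA vF.
- by rewrite mulmxA mulmx_coker mul0mx.
- by rewrite -mulmxA zE.
have [An A0 AC A1] := Auc.
eexists _, _, _; split.
+ apply: (half_splitting_step jal up Auc _ _ ve).
    by move=> _; rewrite dfwith_in dfwith_out // uy.
  by move=> _; rewrite dfwith_in dfwith_out // cy.
+ exact: vert_convex_add Ac An up Ay.
+ by rewrite /= eqxx orbT.
+ by rewrite dfwith_in.
+ by rewrite dfwith_in.
Qed.

(** Transport from [b] is bijective up to [b], so any [v] and [e] with product 1 extend over all of
    that side, and a single step from 0 to everything suffices. *)
Lemma filtered_outward b : (forall x, pos x <= pos b -> reach b x) ->
  (forall al, pos (src al) <= pos b -> pos (tgt al) <= pos b ->
    row_free (B al) /\ row_full (B al)) -> filtered b.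
Proof.
move=> br Binv; pose T x : 'M[k]_(d b, d x) :=
  generated (M := mxrep B (d b)) (1%:M : 'M_(d b)) x.
have bU := line_unique_paths posP (a := b).
have Tb : T b = 1%:M := @generated_id k Q b (mxrep B (d b)) 1%:M bU.
have TB al : reach b (src al) -> T (src al) *m B al = T (tgt al).
  exact: (@generated_map k Q b (mxrep B (d b)) 1%:M bU).
have Tinv x : pos x <= pos b -> row_free (T x) /\ row_full (T x).
  move=> xb; have [n] : exists n : nat, pos x = pos b - n%:Z.
    by exists (absz (pos b - pos x)%R); lia.
  elim: n x xb => [|n IHn] x xb xn.
    have -> : x = b by apply: (pos_inj posP); lia.
    by rewrite Tb row_free_unit row_full_unit unitmx1.
  have [||be [sbe tbe r]] := @reach_cross _ _ (line_pos_opp posP) _ _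
    (- (pos x + 1)) (br x xb); [lia..|].
  have tx : x = tgt be by apply: (pos_inj posP); lia.
  have [||Tfree Tfull] := IHn (src be); [lia..|].
  have [Bfree Bfull] := Binv be ltac:(lia) ltac:(lia).
  rewrite tx -TB //; split.
    by rewrite /row_free mxrankMfree.
  by rewrite /row_full mxrankMfree // (eqP Tfull) -(eqP Bfree).
exists (fun i => if i is 0%N then 0 else 1%:M), 1%N; split=> //.
  by rewrite row_full_unit unitmx1.
move=> i v e _ _ _ ve; pose A : pred (vert Q) := fun x => pos x <= pos b.
exists A, (fun x => if A x then v *m T x else 0).
(* Here [pinvmx (T x)] is a true inverse, so forms are carried over by the inverse of the
   transport. *)
exists (fun x => if A x then pinvmx (T x) *m e else 0); split.
- split.
  + by [].
  + by move=> x /negPf ->.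
  + move=> al sb tb; rewrite /A sb tb; split=> _.
      by rewrite -mulmxA TB //; apply: br.
    have [_ Tfull] := Tinv _ sb; apply: (row_full_inj Tfull).
    rewrite (mulmxA (T (src al)) (B al)) TB; last exact: br.
    rewrite (mulmxA (T (tgt al))) (mulmxA (T (src al))).
    by rewrite !mulmxVp; case: (Tinv _ sb); case: (Tinv _ tb).
  + move=> x xb; rewrite xb mulmxA -(mulmxA v) mulmxVp ?mulmx1 //.
    by case: (Tinv _ xb).
- by move=> x y z _ yb xz zy; rewrite /A; apply: le_trans zy yb.
- by rewrite /A.
- by rewrite /A lexx Tb mulmx1.
- by rewrite /A lexx Tb -[pinvmx _]mul1mx mulmxVp ?mul1mx // row_free_unit
  unitmx1.
Qed.

(** Induction on the distance from [n]: at [n] the space is zero or everything on that side points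
    outwards bijectively, and the orientation of each further arrow selects [filtered_up] or
    [filtered_down]. *)
Lemma filtered_all (n : int) :
  (forall x, pos x <= n -> d x = 0%N) \/
  (forall al, pos (src al) <= n -> pos (tgt al) <= n ->
    [/\ pos (src al) = pos (tgt al) + 1, row_free (B al) & row_full (B al)]) ->
  forall x, n <= pos x -> filtered x.
Proof.
move=> base x nx; have [m] : exists m : nat, pos x = n + m%:Z.
  by exists (absz (pos x - n)%R); lia.
elim: m x {nx} => [|m IHm] x xm.
  case: base => [d0|out]; first by apply/filtered_dim0/d0; lia.
  apply: filtered_outward => [y yx|al sx tx]; last first.
    by have [||_ ? ?] := out al; [lia..|].
  have [j] : exists j : nat, pos y = pos x - j%:Z.
    by exists (absz (pos x - pos y)%R); lia.
  elim: j y yx => [|j IHj] y yx yj.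
    by have -> : y = x; [apply: (pos_inj posP); lia|apply: reach_refl].
  have [||z zy] := @pos_conv _ _ posP y x (pos y + 1); [lia..|].
  have [al alP] := pos_edge posP zy.
  case: alP => [[s t]|[s t]].
    have [||e _ _] := out al; [rewrite s; lia|rewrite t; lia|].
    by move: e; rewrite s t; lia.
  by rewrite -t; apply: reach_arr; rewrite s; apply: IHj; lia.
have [[y yx]|no] := pselect (exists y, pos y = pos x - 1).
  have fy : filtered y by apply: IHm; lia.
  have [|al [[s t]|[s t]]] := pos_edge posP (x := y) (y := x); first lia.
    by rewrite -t; apply: filtered_up; rewrite s ?t //; lia.
  by rewrite -s; apply: filtered_down; rewrite t ?s //; lia.
(* The quiver ends here: no arrow lies to the left of [x], so [filtered_outward] applies. *)
have min y : pos y <= pos x -> y = x.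
  move=> yx; apply: (pos_inj posP); have [//|ne] := eqVneq (pos y) (pos x).
  have [||z zx] := @pos_conv _ _ posP y x (pos x - 1); [lia..|].
  by case: no; exists z.
apply: filtered_outward => [y /min ->|al /min sx /min tx];
  first exact: reach_refl.
by exfalso; have := pos_arr posP al; rewrite sx tx; lia.
Qed.

End HalfSplitting.

Lemma arr_sides (Q : quiver) (pos : vert Q -> int) (al : arr Q) (n : int) :
  line_pos pos -> (pos (src al) <= n /\ pos (tgt al) <= n) \/
                  (n <= pos (src al) /\ n <= pos (tgt al)).
Proof. by move=> posP; have := pos_arr posP al; lia. Qed.

(** With [i.+1] the first index at which [F] is nonzero and [j.+1] the first at which [G] meets
    [F i.+1], the form has to vanish only on [G j], because [F i = 0]. The extensions to both sides
    agree at [a] and are glued there. *)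
Lemma splitting_exists (k : fieldType) (Q : quiver) (pos : vert Q -> int)
    (d : vert Q -> nat) (B : forall al : arr Q, 'M[k]_(d (src al),
      d (tgt al))) a :
  line_pos pos -> filtered B pos a -> filtered B (fun x => - pos x) a ->
  d a <> 0%N ->
  exists A u c, [/\ splitting B A u c, A a & vert_convex pos A].
Proof.
move=> posP [F [N [F0 FN FP]]] [G [L [G0 GL GP]]] da.
have full_neq0 (X : 'M[k]_(d a)) : row_full X -> X != 0.
  by apply: contraTneq => ->; rewrite /row_full mxrank0 eq_sym; apply/eqP.
have exF : exists i, F i != 0 by exists N; apply: full_neq0.
case: (ex_minnP exF) => -[|i]; first by rewrite F0 eqxx.
move=> Fi Fmin; have Fi0 : F i = 0.
  by apply/eqP; apply: contraT => /Fmin; rewrite ltnn.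
have exG : exists j, (F i.+1 :&: G j)%MS != 0.
  exists L; rewrite -submx0; apply: contra Fi; rewrite -submx0.
  by apply: submx_trans; rewrite sub_capmx submx_refl submx_full.
case: (ex_minnP exG) => -[|j].
  by rewrite G0 capmx0 eqxx.
move=> Gj Gmin; have Gj0 : (F i.+1 :&: G j)%MS = 0.
  by apply/eqP; apply: contraT => /Gmin; rewrite ltnn.
set v := nz_row (F i.+1 :&: G j.+1)%MS.
have v0 : v != 0 by rewrite nz_row_eq0.
have /andP[vF vG] : ((v <= F i.+1) && (v <= G j.+1))%MS.
  by rewrite -sub_capmx nz_row_sub.
(* [v] is not in [G j], since it is nonzero and [F i.+1] meets [G j] in 0. *)
have [|e [Ge ve]] := @separate_row _ _ _ v (G j).
  apply: contra v0 => vGj; rewrite -submx0 -Gj0 sub_capmx vF //.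
have iN : (i < N)%N by apply: Fmin; apply: full_neq0.
have jL : (j < L)%N.
  apply: Gmin; rewrite -submx0; apply: contra Fi; rewrite -submx0.
  by apply: submx_trans; rewrite sub_capmx submx_refl submx_full.
have [|A [u [c [[An A0 AC A1] Ac Aa ua ca]]]] := FP i v e iN vF _ ve.
  by rewrite Fi0 mul0mx.
have [A' [u' [c' [[An' A0' AC' A1'] Ac' Aa' ua' ca']]]] := GP j v e jL vG Ge ve.
exists (fun x => if pos x <= pos a then A x else A' x).
exists (fun x => if pos x <= pos a then u x else u' x).
exists (fun x => if pos x <= pos a then c x else c' x).
have glue x : pos a <= pos x ->
    [/\ (if pos x <= pos a then A x else A' x) = A' x,
        (if pos x <= pos a then u x else u' x) = u' x
      & (if pos x <= pos a then c x else c' x) = c' x].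
  move=> ax; case: ifP => // xa.
  have -> : x = a by apply/(pos_inj posP)/le_anti; rewrite xa ax.
  by rewrite Aa Aa' ua ua' ca ca'.
split; last 2 first.
- by rewrite lexx.
- move=> x y z; have [za|za] := leP (pos z) (pos a).
    case: ifP => xa Ax + xz zy; last by rewrite (le_trans xz za) in xa.
    by move=> _; apply: (Ac x a).
  move=> _; case: ifP => ya Ay xz zy;
    first by rewrite ltNge (le_trans zy ya) in za.
  by apply: (Ac' y a); rewrite ?lerN2 // ltW.
split.
- by move=> x; case: ifP => _; [apply: A0|apply: A0'].
- move=> al; have [[sa ta]|[sa ta]] := arr_sides al (pos a) posP.
    by rewrite sa ta; case: (AC al sa ta).
  have [-> -> _] := glue _ sa; have [_ -> _] := glue _ ta.
  by case: (AC' al); rewrite ?lerN2.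
- move=> al; have [[sa ta]|[sa ta]] := arr_sides al (pos a) posP.
    by rewrite sa ta; case: (AC al sa ta).
  have [_ _ ->] := glue _ sa; have [-> _ ->] := glue _ ta.
  by case: (AC' al); rewrite ?lerN2.
- by move=> x; case: ifP => _; [apply: A1|apply: A1'].
Qed.

(** * Finitely presented representations far away *)

Section EventualBehaviour.
Variables (k : fieldType) (Q : quiver).
Implicit Types (M N : rep k Q) (al : arr Q).

Definition bij_map M al : Prop :=
  injective (rep_map M al) /\ forall t, exists v, rep_map M al v = t.

Lemma bij_map_iso M N al : rep_iso M N -> bij_map M al -> bij_map N al.
Proof.
case=> f [g fg] [inj surj]; have [fK gK] := fg (tgt al); have [fK' gK'] :=
  fg (src al).
split=> [u v e|t].
  apply: (can_inj gK'); apply: inj; apply: (can_inj fK).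
  by rewrite !hom_comm !gK'.
have [v vE] := surj (g _ t); exists (f _ v).
by rewrite -hom_comm vE gK.
Qed.

Lemma bij_map_thin (A : pred (vert Q)) al : A (src al) = A (tgt al) ->
  bij_map (thin k A) al.
Proof.
rewrite /bij_map /=; case: (A (src al)); case: (A (tgt al)) => //= _.
  by split=> // t; exists t.
by split=> [u v _|t]; [apply/rowP=> -[]|exists 0; apply/rowP=> -[]].
Qed.

Lemma bij_map_dsum M N al : bij_map M al -> bij_map N al ->
  bij_map (dsum_rep M N) al.
Proof.
case=> [i s] [i' s']; split=> [[u v] [u' v'] [/i -> /i' ->] //|[t t']].
by have [v <-] := s t; have [v' <-] := s' t'; exists (v, v').
Qed.

Lemma proj_sum_bij (pos : vert Q -> int) (s : seq (vert Q)) al : line_pos pos ->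
  (forall a, a \in s -> reach a (src al) = reach a (tgt al)) ->
  bij_map (proj_sum k s) al.
Proof.
move=> posP; elim: s => [|a s IHs] sP.
  by split=> [u v _|t]; [apply/rowP=> -[]|exists 0; apply/rowP=> -[]].
apply: bij_map_dsum; last first.
  by apply: IHs => b bs; apply: sP; rewrite inE bs orbT.
apply: bij_map_iso (thin_reach_iso k (line_unique_paths posP (a := a))) _.
by apply: bij_map_thin; apply: sP; rewrite mem_head.
Qed.

Lemma proj_sum_eq0 (pos : vert Q -> int) (s : seq (vert Q)) x (u :
  proj_sum k s x) : line_pos pos ->
  (forall a, a \in s -> ~~ reach a x) -> u = 0.
Proof.
move=> posP; elim: s u => [|a s IHs] u sP; first by apply/rowP=> -[].
case: u => u v; congr (_, _); last first.
  by apply: IHs => b bs; apply: sP; rewrite inE bs orbT.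
have [f [g fg]] := thin_reach_iso k (line_unique_paths posP (a := a)).
have [_ gK] := fg x; apply: (can_inj gK).
have na : ~~ reach a x by apply: sP; rewrite mem_head.
by rewrite [LHS](thin_eq0 _ na) [RHS](thin_eq0 _ na).
Qed.

(** Beyond all generators, an inward arrow blocks every cone, so the projectives and hence [M]
    vanish past it. Otherwise all arrows point outwards and act bijectively on both projectives,
    hence on their cokernel [M]. *)
Lemma finitely_presented_eventually (pos : vert Q -> int) M :
  line_pos pos -> finitely_presented M ->
  exists n : int, (forall x, n <= pos x -> forall u : M x, u = 0) \/
    forall al, n <= pos (src al) -> n <= pos (tgt al) ->
      pos (tgt al) = pos (src al) + 1 /\ bij_map M al.
Proof.
move=> posP [s1 [s0 [f [g fg]]]].
have [n nP] := pos_bounded pos (s1 ++ s0).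
have n1 a : a \in s1 -> pos a <= n by move=> as1; apply: nP;
  rewrite mem_cat as1.
have n0 a : a \in s0 -> pos a <= n.
  by move=> as0; apply: nP; rewrite mem_cat as0 orbT.
have [[al [ns nt alP]]|no] := pselect (exists al, [/\ n <= pos (src al),
    n <= pos (tgt al) & pos (src al) = pos (tgt al) + 1]).
  exists (pos (src al)); left=> x xs u; have [_ _ /(_ u)[v <-]] := fg x.
  rewrite (@proj_sum_eq0 pos s0 x v) ?linear0 // => a /n0 an.
  apply/negP => r; have [||be [e1 e2 _]] := reach_cross posP (m :=
    pos (tgt al)) r.
  - by apply: le_trans nt.
  - by rewrite alP in xs; lia.
  by apply: (antiparallelF posP (al := al) (be := be)); lia.
exists n; right=> al ns nt.
have alP : pos (tgt al) = pos (src al) + 1.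
  by case: (pos_arr posP al) => // e; case: no; exists al.
split=> //.
have reachE a : pos a <= n -> reach a (src al) = reach a (tgt al).
  move=> an; apply/idP/idP=> [|r]; first exact: reach_arr.
  have [||be [e1 e2 r']] := reach_cross posP (m := pos (src al)) r.
  - exact: le_trans ns.
  - by rewrite alP; lia.
  by rewrite (@parallel_eq _ _ posP al be) ?e1 ?e2 ?alP.
have [inj1 surj1] : bij_map (proj_sum k s1) al.
  by apply: (proj_sum_bij posP) => a /n1/reachE.
have [inj0 surj0] : bij_map (proj_sum k s0) al.
  by apply: (proj_sum_bij posP) => a /n0/reachE.
have [_ kers surjs] := fg (src al); have [_ kert surjt] := fg (tgt al).
split.
  apply: raddf_inj => m m0; have [v vE] := surjs m.
  have /kert[u uE] : g _ (rep_map _ al v) = 0 by rewrite hom_comm vE.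
  have [u' u'E] := surj1 u.
  rewrite -vE; apply/kers; exists u'; apply: inj0.
  by rewrite -hom_comm u'E uE.
move=> t; have [v vE] := surjt t; have [v' v'E] := surj0 v.
by exists (g _ v'); rewrite -hom_comm v'E vE.
Qed.

Lemma bij_map_mxrep (d : vert Q -> nat)
    (B : forall al : arr Q, 'M[k]_(d (src al), d (tgt al))) al :
  bij_map (mxrep B 1) al -> row_free (B al) /\ row_full (B al).
Proof.
case=> inj surj; split.
  rewrite -kermx_eq0; apply/eqP/row_matrixP=> i; apply: inj.
  by rewrite row0 [LHS]/= [RHS]/= -row_mul mulmx_ker row0 mul0mx.
rewrite -sub1mx; apply/row_subP=> i; have [v <-] := surj (row i 1%:M).
exact: submxMl.
Qed.

Lemma filtered_fp (pos : vert Q -> int) (d : vert Q -> nat)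
    (B : forall al : arr Q, 'M[k]_(d (src al), d (tgt al))) a :
  line_pos pos -> finitely_presented (mxrep B 1) -> filtered B pos a.
Proof.
move=> posP fp.
have [n nP] := finitely_presented_eventually (line_pos_opp posP) fp.
(* The bound is [- n] because positions were negated; the minimum with [pos a] puts [a] within reach
   of the induction. *)
apply: (filtered_all posP (n := Num.min (- n) (pos a))); last lia.
case: nP => [zero|out]; [left=> x xn|right=> al sn tn].
  apply/eqP; rewrite -leqn0 leqNgt; apply/negP=> dx.
  have /rowP/(_ (Ordinal dx)) := zero x ltac:(lia) (const_mx 1).
  by rewrite !mxE => /eqP; rewrite oner_eq0.
have [||e /bij_map_mxrep[free full]] := out al; [lia..|].
by split=> //; lia.
Qed.

Lemma thin_fp_tail (pos : vert Q -> int) (A : pred (vert Q)) a :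
  line_pos pos -> vert_convex pos A -> A a -> finitely_presented (thin k A) ->
  tail pos A.
Proof.
move=> posP Ac Aa /(finitely_presented_eventually posP)[n nP].
case: nP => [zero|out].
  exists n; left=> x Ax; rewrite ltNge; apply/negP=> nx.
  have := thin_coef_one k Ax;
    rewrite (zero x nx (thin_one k A x)) /thin_coef linear0.
  by move/eqP; rewrite eq_sym oner_eq0.
have [[b bP]|nb] := pselect (exists b, forall x, A x -> pos x < b).
  by exists b; left.
exists (Num.max n (pos a)); right; split=> [m nm|al ns nt]; last first.
  by have [||] := out al; [lia..|].
have [y [Ay my]] : exists y, A y /\ m <= pos y.
  apply: contrapT => no; apply: nb; exists m => y Ay.
  by rewrite ltNge; apply/negP=> my; apply: no; exists y.
have [||z zm] := pos_conv posP (x := a) (y := y) (m := m); [lia..|].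
by exists z => //; apply: Ac Aa Ay _ _; lia.
Qed.

Lemma indecomposable_fp_thin (pos : vert Q -> int) M : line_pos pos ->
  locally_finite_dim M -> indecomposable M -> finitely_presented M ->
  exists (A : pred (vert Q)) a, [/\ A a,
    vert_convex pos A & rep_iso M (thin k A)].
Proof.
move=> posP Mf Mind Mfp; have [d [B MB]] := mxrep_exists Mf.
have fpB := finitely_presented_iso MB Mfp.
have [B0 Bind] := indecomposable_iso MB Mind.
have [a da] : exists a, d a <> 0%N.
  apply: contrapT => no; apply: B0 => x u; apply/rowP=> -[j jd].
  by case: no; exists x => dx; move: jd; rewrite dx.
have [A [u [c [uc Aa Ac]]]] := splitting_exists posP
  (filtered_fp a posP fpB) (filtered_fp a (line_pos_opp posP) fpB) da.
exists A, a; split=> //; apply: rep_iso_trans MB _.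
apply: rep_iso_trans (splitting_iso uc) _.
have [A0|C0] := Bind _ _ (thin_locally_finite_dim k A)
  (complement_locally_finite_dim B c) (splitting_iso uc).
  by case: (thin_neq0 Aa A0).
exact: dsum_zero_isor.
Qed.

End EventualBehaviour.

Theorem proposition5p9 (k : fieldType) (Q : quiver)
    (hQ : type_Ainfinf Q \/ type_Ainf Q)
    (M : rep k Q) (hM : locally_finite_dim M) (hind : indecomposable M) :
  finitely_presented M <->
  exists w : edge_product Q,
    [/\ is_string w, ~ has_left_infinite_path w & rep_iso M (string_rep k w)].
Proof.
have [pos posP] := line_pos_exists hQ; have posN := line_pos_opp posP.
split=> [Mfp|[w [wS noleft Mw]]]; last first.
  have [wW wR _ _] := wS.
  apply: finitely_presented_iso (rep_iso_sym Mw) _.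
  apply: finitely_presented_iso (rep_iso_sym (string_rep_iso k posP wW wR)) _.
  by apply: (tails_finitely_presented k posP); apply: string_tail.
have [A [a [Aa Ac MA]]] := indecomposable_fp_thin posP hM hind Mfp.
have Afp := finitely_presented_iso MA Mfp.
have tr := thin_fp_tail posP Ac Aa Afp.
have tl := thin_fp_tail posN (vert_convex_opp Ac) Aa Afp.
(* The interval becomes the vertex set of a walk, for which the two tails give the string
   conditions. *)
have [|w [wW wR wA]] := walk_of_convex posP Ac; first by exists a.
have AE : A = walk_support w.
  by apply/funext=> x; apply/idP/asboolP=> /wA.
rewrite AE in tr tl MA; have [|wS noleft] := tails_string posP wW wR _ tr tl.
  by exists a; apply/wA.
exists w; split=> //; apply: rep_iso_trans MA _.
exact: rep_iso_sym (string_rep_iso k posP wW wR).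
Qed.
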